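(* There is a computable age $\mathbb K$, which is the canonical computable age of some (computable) structure in a finite relational language, such that $\mathbb K$ has the cofinal amalgamation property (CAP) but, for every Turing degree $\mathfrak s$, if $\mathbb K$ has the $\mathfrak s$-computable cofinal amalgamation property $\mathfrak s$-(cCAP), then $\mathbf{0'}\leq_{\mathrm T}\mathfrak s$.
   Context: Languages and structures. $\mathcal{L}$ is a countable language with a computable representation: relation symbols $R_n$ (of positive arity) and function symbols $F_m$ are indexed bijectively by disjoint computable subsets of $\omega$, with arity computable from the index. An $\mathcal{L}$-structure $\mathcal{M}$ is c.e. if its underlying set $M$ is a c.e. subset of $\omega$ and the sets $\{(n,\mathbf a): \mathcal M\models R_n(\mathbf a)\}$, $\{(n,\mathbf a): \mathcal M\models \neg R_n(\mathbf a)\}$, $\{(m,\mathbf a,b): \mathcal M\models F_m(\mathbf a)=b\}$ are c.e.; it is computable if moreover $M$ is computable. Tuples are finite; $\mathrm{cl}_{\mathcal M}(\mathbf a)$ is the smallest substructure of $\mathcal M$ containing $\mathbf a$. For $\mathbf a\in\mathcal A$, $\mathbf b\in\mathcal B$ of the same length, $\mathbf a\simeq\mathbf b$ means that for every atomic $\mathcal L$-formula $\varphi$, $\mathcal A\models\varphi(\mathbf a)$ iff $\mathcal B\models\varphi(\mathbf b)$; equivalently $\mathbf a\mapsto\mathbf b$ extends to an isomorphism $\mathrm{cl}(\mathbf a)\to\mathrm{cl}(\mathbf b)$. $\mathbf{0'}$ is the Turing jump of the least Turing degree. Ages. An age is a collection of finitely generated $\mathcal L$-structures closed under isomorphism. A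 computable age (computable representation of an age $\mathcal K$) is a c.e. set $\mathbb K$ of triples $(\mathbf a,\mathcal A,i)$ (computable structures being given by indices), with exactly one triple for each $i\in\omega$, written $\mathbb I(i)=(\mathbf a_i,\mathcal A_i,i)$, such that each $\mathcal A_i$ is a computable $\mathcal L$-structure in $\mathcal K$ with $\mathcal A_i=\mathrm{cl}_{\mathcal A_i}(\mathbf a_i)$, and every $\mathcal B\in\mathcal K$ is isomorphic to some $\mathcal A_i$. $\mathbb K$ is said to have a property of ages if $\mathcal K$ does. For a computable structure $\mathcal M$, a canonical computable age of $\mathcal M$ is the sequence $(\mathbf a_i,\mathrm{cl}_{\mathcal M}(\mathbf a_i),i)_{i\in\omega}$, where $(\mathbf a_i)_{i\in\omega}$ is a computable enumeration of all finite tuples in $\mathcal M$ in which every tuple appears infinitely often (any two are computably isomorphic); it represents the age of $\mathcal M$, i.e. the collection of structures isomorphic to a finitely generated substructure of $\mathcal M$. Embeddings and amalgamation diagrams. A potential embedding in $\mathbb K$ is a triple $F=(\mathbb I(i),\mathbb I(j),\mathbf c)$ with $\mathbf c\in\mathcal A_j$; $\mathrm{dom}(F)=\mathbb I(i)$, $\mathrm{codom}(F)=\mathbb I(j)$. It is an embedding if $\mathbf a_i\simeq\mathbf c$ (it then encodes the embedding $\mathcal A_i\to\mathcal A_j$ sending $\mathbf a_i$ to $\mathbf c$); composition of embeddings is composition of the encoded maps, and an isomorphism is an embedding whose encoded map is onto. A potential span is a pair $(F_0,F_1)$ of potential embeddings with $\mathrm{dom}(F_0)=\mathrm{dom}(F_1)$;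 it is a span if both are embeddings. An amalgamation diagram over a potential span $(F_0,F_1)$ is a pair $(G_0,G_1)$ with $G_0$ an embedding, $G_1$ a potential embedding, $\mathrm{dom}(G_i)=\mathrm{codom}(F_i)$ for $i\in\{0,1\}$, $\mathrm{codom}(G_0)=\mathrm{codom}(G_1)$, and such that if $(F_0,F_1)$ is a span then $G_1$ is an embedding and $G_0\circ F_0=G_1\circ F_1$. Cofinal amalgamation. An amalgamation base is an $\mathcal A'\in\mathcal K$ such that whenever $\mathcal B,\mathcal C\in\mathcal K$ and $f_{\mathcal B}:\mathcal A'\to\mathcal B$, $f_{\mathcal C}:\mathcal A'\to\mathcal C$ are embeddings, there are $\mathcal D\in\mathcal K$ and embeddings $\alpha_{\mathcal B}:\mathcal B\to\mathcal D$, $\alpha_{\mathcal C}:\mathcal C\to\mathcal D$ with $\alpha_{\mathcal B}\circ f_{\mathcal B}=\alpha_{\mathcal C}\circ f_{\mathcal C}$. (CAP): every $\mathcal A\in\mathcal K$ embeds into some amalgamation base in $\mathcal K$. A collection of distinguished extensions is a collection of embeddings in $\mathbb K$ closed under pre- and post-composition with isomorphisms between elements of $\mathbb K$ and such that every $\mathbb I(i)$ is the domain of some member. A witness to (CAP) is a pair $(\mathrm{AB},f)$ where $\mathrm{AB}$ is a collection of distinguished extensions each of whose members has an amalgamation base as codomain, and $f$ takes each tuple $(F,G_0,G_1)$ with $F\in\mathrm{AB}$, $(G_0,G_1)$ a potential span and $\mathrm{dom}(G_0)=\mathrm{dom}(G_1)=\mathrm{codom}(F)$ to an amalgamation diagram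 over $(G_0,G_1)$. It is $\mathfrak s$-computable if $\mathrm{AB}$ is $\mathfrak s$-c.e. and $f$ is an $\mathfrak s$-computable partial function. $\mathbb K$ has $\mathfrak s$-(cCAP) if it has an $\mathfrak s$-computable witness to (CAP). *)

(* Defs.v *)
From Stdlib Require Import Arith Cantor List.
Import ListNotations.

Set Implicit Arguments.

(** * Oracle computability *)

Definition npair (x y : nat) : nat := Cantor.to_nat (x, y).
Definition nfst (n : nat) : nat := fst (Cantor.of_nat n).
Definition nsnd (n : nat) : nat := snd (Cantor.of_nat n).

Fixpoint list_code (l : list nat) : nat :=
  match l with
  | [] => 0
  | x :: l' => S (npair x (list_code l'))
  end.

(** Programs for the partial recursive functions relative to an oracle; they
    are unary, several arguments being packed with [npair]. *)
Inductive code : Type :=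
| CZero | CSucc | CFst | CSnd
| COracle
| CPair (c d : code)
| CComp (c d : code)
| CPrec (c d : code)
| CMu (c : code).

(** [eval X c x y]: program [c] with oracle [X] halts on input [x] with output
    [y].  [CPrec c d] maps [npair a 0] to [c a] and [npair a (k + 1)] to
    [d (npair a (npair k r))], [r] being the value at [npair a k];  [CMu c]
    maps [x] to the least [y] with [c (npair x y) = 0], all earlier values
    being required to be defined. *)
Fixpoint eval (X : nat -> Prop) (c : code) : nat -> nat -> Prop :=
  match c with
  | CZero => fun _ y => y = 0
  | CSucc => fun x y => y = S x
  | CFst => fun x y => y = nfst x
  | CSnd => fun x y => y = nsnd x
  | COracle => fun x y => (X x /\ y = 1) \/ (~ X x /\ y = 0)
  | CPair c d => fun x y =>
      exists u v, eval X c x u /\ eval X d x v /\ y = npair u v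
  | CComp c d => fun x y => exists u, eval X d x u /\ eval X c u y
  | CPrec c d => fun x =>
      nat_rect (fun _ => nat -> Prop)
        (fun y => eval X c (nfst x) y)
        (fun k R y => exists r,
             R r /\ eval X d (npair (nfst x) (npair k r)) y)
        (nsnd x)
  | CMu c => fun x y =>
      eval X c (npair x y) 0 /\
      forall z, z < y -> exists v, eval X c (npair x z) (S v)
  end.

Fixpoint code_num (c : code) : nat :=
  match c with
  | CZero => npair 0 0
  | CSucc => npair 1 0
  | CFst => npair 2 0
  | CSnd => npair 3 0
  | COracle => npair 4 0
  | CPair c d => npair 5 (npair (code_num c) (code_num d))
  | CComp c d => npair 6 (npair (code_num c) (code_num d))
  | CPrec c d => npair 7 (npair (code_num c) (code_num d))
  | CMu c => npair 8 (code_num c)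
  end.

(** [phi X e x y]: the [e]-th partial [X]-computable function sends [x] to
    [y].  It is nowhere defined if [e] is not the number of a program. *)
Definition phi (X : nat -> Prop) (e x y : nat) : Prop :=
  exists c, code_num c = e /\ eval X c x y.

Definition W (X : nat -> Prop) (e x : nat) : Prop := exists y, phi X e x y.

Definition char_index (X : nat -> Prop) (e : nat) (Y : nat -> Prop) : Prop :=
  forall x, (Y x -> phi X e x 1) /\ (~ Y x -> phi X e x 0).

Definition ce_index (X : nat -> Prop) (e : nat) (Y : nat -> Prop) : Prop :=
  forall x, W X e x <-> Y x.

Definition turing_le (Y X : nat -> Prop) : Prop := exists e, char_index X e Y.

Definition ce_in (X Y : nat -> Prop) : Prop := exists e, ce_index X e Y.

Definition empty_oracle : nat -> Prop := fun _ => False.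

Definition computable (Y : nat -> Prop) : Prop := turing_le Y empty_oracle.
Definition ce (Y : nat -> Prop) : Prop := ce_in empty_oracle Y.

Definition jump (X : nat -> Prop) : nat -> Prop := fun e => W X e e.

Definition zero_jump : nat -> Prop := jump empty_oracle.

(** * Languages and structures *)

Record language : Type := Language {
  rel_sym : nat -> Prop;
  fun_sym : nat -> Prop;
  arity : nat -> nat;
  sym_disjoint : forall n, rel_sym n -> fun_sym n -> False;
  rel_arity_pos : forall n, rel_sym n -> 0 < arity n;
  rel_sym_computable : computable rel_sym;
  fun_sym_computable : computable fun_sym;
  arity_computable : exists e, forall n,
      rel_sym n \/ fun_sym n -> phi empty_oracle e n (arity n)
}.

Definition finite_relational (L : language) : Prop :=
  (forall m, ~ fun_sym L m) /\
  (exists l : list nat, forall n, rel_sym L n -> In n l).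

(** An [L]-structure whose underlying set is the subset [dom] of an ambient
    type [T].  Only the values of [rel] and [fn] at symbols of [L] and tuples
    of the right length from [dom] matter; everything below ignores the
    others.  As [fn] is total, [T] is inhabited, but [dom] may be empty. *)
Record structure (L : language) (T : Type) : Type := Structure {
  dom : T -> Prop;
  rel : nat -> list T -> Prop;
  fn : nat -> list T -> T;
  fn_closed : forall m a, fun_sym L m -> length a = arity L m ->
                          Forall dom a -> dom (fn m a)
}.

Definition rel_args L T (A : structure L T) (n : nat) (a : list T) : Prop :=
  rel_sym L n /\ length a = arity L n /\ Forall (dom A) a.

Definition fn_args L T (A : structure L T) (m : nat) (a : list T) : Prop :=
  fun_sym L m /\ length a = arity L m /\ Forall (dom A) a.

(** Two presentations of the same structure. *)
Definition same_structure L T (A B : structure L T) : Prop :=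
  (forall x, dom A x <-> dom B x) /\
  (forall n a, rel_args A n a -> (rel A n a <-> rel B n a)) /\
  (forall m a, fn_args A m a -> fn A m a = fn B m a).

Definition is_embedding L T U (A : structure L T) (B : structure L U)
    (f : T -> U) : Prop :=
  (forall x, dom A x -> dom B (f x)) /\
  (forall x y, dom A x -> dom A y -> f x = f y -> x = y) /\
  (forall n a, rel_args A n a -> (rel A n a <-> rel B n (map f a))) /\
  (forall m a, fn_args A m a -> f (fn A m a) = fn B m (map f a)).

Definition is_isomorphism L T U (A : structure L T) (B : structure L U)
    (f : T -> U) : Prop :=
  is_embedding A B f /\ forall y, dom B y -> exists x, dom A x /\ f x = y.

Definition isomorphic L T U (A : structure L T) (B : structure L U) : Prop :=
  exists f, is_isomorphism A B f.

Definition closed_in L T (A : structure L T) (P : T -> Prop) : Prop :=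
  forall m a, fun_sym L m -> length a = arity L m -> Forall P a -> P (fn A m a).

Definition cl L T (A : structure L T) (a : list T) (x : T) : Prop :=
  forall P : T -> Prop, Forall P a -> closed_in A P -> P x.

Lemma cl_closed L T (A : structure L T) (a : list T) : closed_in A (cl A a).
Proof.
intros m xs Hm Hl Hxs P Ha HP. apply HP; trivial.
eapply Forall_impl; [|exact Hxs]. intros x Hx. apply Hx; trivial.
Qed.

Definition cl_structure L T (A : structure L T) (a : list T) : structure L T :=
  @Structure L T (cl A a) (rel A) (fn A) (@cl_closed L T A a).

Definition finitely_generated L T (A : structure L T) : Prop :=
  exists a, Forall (dom A) a /\ forall x, dom A x -> cl A a x.

(** * Atomic types of tuples *)

Inductive term : Type :=
| Var (i : nat)
| App (m : nat) (ts : list term).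

Inductive atomic : Type :=
| Eq (s t : term)
| Rel (n : nat) (ts : list term).

(** Well-formed terms of [L] in the variables [0, ..., k - 1]. *)
Inductive wf_term (L : language) (k : nat) : term -> Prop :=
| wf_Var i : i < k -> wf_term L k (Var i)
| wf_App m ts : fun_sym L m -> length ts = arity L m ->
    (forall t, In t ts -> wf_term L k t) -> wf_term L k (App m ts).

Definition wf_atomic (L : language) (k : nat) (p : atomic) : Prop :=
  match p with
  | Eq s t => wf_term L k s /\ wf_term L k t
  | Rel n ts => rel_sym L n /\ length ts = arity L n /\
                forall t, In t ts -> wf_term L k t
  end.

(** The default value in [nth] is never reached on well-formed terms. *)
Fixpoint term_val L T (A : structure L T) (a : list T) (t : term) : T :=
  match t with
  | Var i => nth i a (fn A 0 [])
  | App m ts => fn A m (map (term_val A a) ts)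
  end.

Definition satisfies L T (A : structure L T) (a : list T) (p : atomic) : Prop :=
  match p with
  | Eq s t => term_val A a s = term_val A a t
  | Rel n ts => rel A n (map (term_val A a) ts)
  end.

(** [a] in [A] and [b] in [B] satisfy [a ≃ b]. *)
Definition atomic_equiv L T U (A : structure L T) (a : list T)
    (B : structure L U) (b : list U) : Prop :=
  length a = length b /\
  forall p, wf_atomic L (length a) p -> (satisfies A a p <-> satisfies B b p).

(** * Computable structures *)

Definition rel_set L (A : structure L nat) : nat -> Prop := fun x =>
  exists n a, x = npair n (list_code a) /\ rel_args A n a /\ rel A n a.

Definition neg_rel_set L (A : structure L nat) : nat -> Prop := fun x =>
  exists n a, x = npair n (list_code a) /\ rel_args A n a /\ ~ rel A n a.

Definition fn_set L (A : structure L nat) : nat -> Prop := fun x =>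
  exists m a, x = npair m (npair (list_code a) (fn A m a)) /\ fn_args A m a.

(** [e] is an index of the computable structure [A]. *)
Definition structure_index L (e : nat) (A : structure L nat) : Prop :=
  exists d p q g,
    e = npair d (npair p (npair q g)) /\
    char_index empty_oracle d (dom A) /\
    ce_index empty_oracle p (rel_set A) /\
    ce_index empty_oracle q (neg_rel_set A) /\
    ce_index empty_oracle g (fn_set A).

Definition computable_structure L (A : structure L nat) : Prop :=
  exists e, structure_index e A.

(** * Ages *)

Lemma isomorphic_trans L T U V (A : structure L T) (B : structure L U)
    (C : structure L V) :
  isomorphic A B -> isomorphic B C -> isomorphic A C.
Proof.
intros [f [[f1 [f2 [f3 f4]]] f5]] [g [[g1 [g2 [g3 g4]]] g5]].
assert (M : forall a, Forall (dom A) a -> Forall (dom B) (map f a)).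
{ intros a Ha. apply Forall_map. eapply Forall_impl; [|exact Ha]. exact f1. }
exists (fun x => g (f x)). repeat split.
- auto.
- auto 10.
- intros Hr. rewrite <- map_map. destruct H as [H1 [H2 H3]].
  apply g3; [|apply f3; [|exact Hr]]; repeat split; auto.
  now rewrite length_map.
- rewrite <- map_map. intros Hr. destruct H as [H1 [H2 H3]].
  apply f3; [|apply g3; [|exact Hr]]; repeat split; auto.
  now rewrite length_map.
- intros m a [H1 [H2 H3]]. rewrite <- map_map, f4, g4; repeat split; auto.
  now rewrite length_map.
- intros z Hz. destruct (g5 z Hz) as [y [Hy <-]].
  destruct (f5 y Hy) as [x [Hx <-]]. eauto.
Qed.

Lemma finitely_generated_iso L T U (A : structure L T) (B : structure L U) :
  isomorphic A B -> finitely_generated A -> finitely_generated B.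
Proof.
intros [f [[f1 [f2 [f3 f4]]] f5]] [a [Ha Hcl]].
exists (map f a). split.
- apply Forall_map. eapply Forall_impl; [|exact Ha]. exact f1.
- intros y Hy P HP HPcl. destruct (f5 y Hy) as [x [Hx <-]].
  apply (Hcl x Hx (fun x => dom A x /\ P (f x))).
  + apply Forall_and; [exact Ha|]. now apply Forall_map.
  + intros m xs Hm Hl Hxs. apply Forall_and_inv in Hxs as [H1 H2]. split.
    * now apply fn_closed.
    * rewrite f4 by (repeat split; trivial). apply HPcl; trivial.
      -- now rewrite length_map.
      -- now apply Forall_map.
Qed.

Record age (L : language) : Type := Age {
  in_age : forall T : Type, structure L T -> Prop;
  age_fg : forall T (A : structure L T), in_age A -> finitely_generated A;
  age_iso : forall T U (A : structure L T) (B : structure L U),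
      in_age A -> isomorphic A B -> in_age B
}.

(** The code of the triple [(a, A, i)], where [e] is an index of [A]. *)
Definition triple_code (a : list nat) (e i : nat) : nat :=
  npair (list_code a) (npair e i).

(** [gens K i], [str K i] and [idx K i] are the tuple [a_i], the structure
    [A_i] and its index.  The age that is represented is [age_of K] below. *)
Record computable_age (L : language) : Type := ComputableAge {
  gens : nat -> list nat;
  str : nat -> structure L nat;
  idx : nat -> nat;
  str_index : forall i, structure_index (idx i) (str i);
  gens_dom : forall i, Forall (dom (str i)) (gens i);
  gens_cl : forall i x, dom (str i) x <-> cl (str i) (gens i) x;
  triples_ce : ce (fun n => exists i, n = triple_code (gens i) (idx i) i)
}.

Definition represented L (K : computable_age L) (T : Type) (B : structure L T)
  : Prop := exists i, isomorphic (str K i) B.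

Lemma represented_fg L (K : computable_age L) T (B : structure L T) :
  represented K B -> finitely_generated B.
Proof.
intros [i Hi]. apply (finitely_generated_iso Hi). exists (gens K i). split.
- apply gens_dom.
- intros x Hx. now apply gens_cl.
Qed.

Lemma represented_iso L (K : computable_age L) T U
    (A : structure L T) (B : structure L U) :
  represented K A -> isomorphic A B -> represented K B.
Proof. intros [i Hi] H. exists i. eapply isomorphic_trans; eassumption. Qed.

Definition age_of L (K : computable_age L) : age L :=
  @Age L (represented K) (@represented_fg L K) (@represented_iso L K).

(** [K] is a canonical computable age of [M]. *)
Definition canonical_age L (M : structure L nat) (K : computable_age L) : Prop :=
  (exists e, forall i, phi empty_oracle e i (list_code (gens K i))) /\
  (forall i, Forall (dom M) (gens K i)) /\
  (forall a, Forall (dom M) a -> forall N, exists i, N <= i /\ gens K i = a) /\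
  (forall i, same_structure (str K i) (cl_structure M (gens K i))).

(** * Embeddings and amalgamation diagrams *)

(** The triple [(I(src), I(tgt), pt)]. *)
Record emb : Type := Emb { src : nat; tgt : nat; pt : list nat }.

Definition emb_code L (K : computable_age L) (F : emb) : nat :=
  npair (triple_code (gens K (src F)) (idx K (src F)) (src F))
    (npair (triple_code (gens K (tgt F)) (idx K (tgt F)) (tgt F))
       (list_code (pt F))).

Definition potential L (K : computable_age L) (F : emb) : Prop :=
  Forall (dom (str K (tgt F))) (pt F).

Definition is_emb L (K : computable_age L) (F : emb) : Prop :=
  potential K F /\
  atomic_equiv (str K (src F)) (gens K (src F)) (str K (tgt F)) (pt F).

(** [f] is the map encoded by [F]; it is determined on [str K (src F)]. *)
Definition encodes L (K : computable_age L) (F : emb) (f : nat -> nat) : Prop :=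
  is_embedding (str K (src F)) (str K (tgt F)) f /\
  map f (gens K (src F)) = pt F.

Definition is_iso L (K : computable_age L) (F : emb) : Prop :=
  is_emb K F /\
  exists f, encodes K F f /\
    forall y, dom (str K (tgt F)) y ->
              exists x, dom (str K (src F)) x /\ f x = y.

(** [E] is the composite of [F] followed by [G]. *)
Definition is_comp L (K : computable_age L) (G F E : emb) : Prop :=
  tgt F = src G /\ src E = src F /\ tgt E = tgt G /\
  exists f g, encodes K F f /\ encodes K G g /\ encodes K E (fun x => g (f x)).

Definition potential_span L (K : computable_age L) (F0 F1 : emb) : Prop :=
  potential K F0 /\ potential K F1 /\ src F0 = src F1.

Definition span L (K : computable_age L) (F0 F1 : emb) : Prop :=
  potential_span K F0 F1 /\ is_emb K F0 /\ is_emb K F1.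

Definition amalgamation_diagram L (K : computable_age L)
    (F0 F1 G0 G1 : emb) : Prop :=
  is_emb K G0 /\ potential K G1 /\
  src G0 = tgt F0 /\ src G1 = tgt F1 /\ tgt G0 = tgt G1 /\
  (span K F0 F1 ->
     is_emb K G1 /\ exists E, is_comp K G0 F0 E /\ is_comp K G1 F1 E).

(** * Cofinal amalgamation *)

Definition amalgamation_base L (C : age L) T (A : structure L T) : Prop :=
  in_age C A /\
  forall U V (B1 : structure L U) (B2 : structure L V) (f1 : T -> U) (f2 : T -> V),
    in_age C B1 -> in_age C B2 ->
    is_embedding A B1 f1 -> is_embedding A B2 f2 ->
    exists (Z : Type) (D : structure L Z) (g1 : U -> Z) (g2 : V -> Z),
      in_age C D /\ is_embedding B1 D g1 /\ is_embedding B2 D g2 /\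
      forall x, dom A x -> g1 (f1 x) = g2 (f2 x).

Definition CAP L (C : age L) : Prop :=
  forall T (A : structure L T), in_age C A ->
    exists (U : Type) (A' : structure L U) (f : T -> U),
      amalgamation_base C A' /\ is_embedding A A' f.

Definition distinguished_extensions L (K : computable_age L)
    (X : emb -> Prop) : Prop :=
  (forall F, X F -> is_emb K F) /\
  (forall F H E, X F -> is_iso K H -> is_comp K F H E -> X E) /\
  (forall F H E, X F -> is_iso K H -> is_comp K H F E -> X E) /\
  (forall i, exists F, X F /\ src F = i).

(** [f] is a partial function, [None] meaning undefined. *)
Definition CAP_witness L (K : computable_age L) (AB : emb -> Prop)
    (f : emb -> emb -> emb -> option (emb * emb)) : Prop :=
  distinguished_extensions K AB /\
  (forall F, AB F -> amalgamation_base (age_of K) (str K (tgt F))) /\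
  (forall F G0 G1, AB F -> potential_span K G0 G1 -> src G0 = tgt F ->
     exists H0 H1,
       f F G0 G1 = Some (H0, H1) /\ amalgamation_diagram K G0 G1 H0 H1).

Definition computable_witness L (K : computable_age L) (s : nat -> Prop)
    (AB : emb -> Prop) (f : emb -> emb -> emb -> option (emb * emb)) : Prop :=
  ce_in s (fun n => exists F, AB F /\ n = emb_code K F) /\
  exists e, forall F G0 G1 H0 H1,
    f F G0 G1 = Some (H0, H1) <->
    phi s e (npair (emb_code K F) (npair (emb_code K G0) (emb_code K G1)))
            (npair (emb_code K H0) (emb_code K H1)).

(** [s]-(cCAP), where the set [s] represents its Turing degree. *)
Definition cCAP L (K : computable_age L) (s : nat -> Prop) : Prop :=
  exists AB f, CAP_witness K AB f /\ computable_witness K s AB f.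

(** * Sanity check: a canonical computable age of [M] represents the age of [M] *)

Lemma same_structure_iso L T (A B : structure L T) :
  same_structure A B -> isomorphic A B /\ isomorphic B A.
Proof.
intros [H1 [H2 H3]].
assert (HF : forall a, Forall (dom B) a -> Forall (dom A) a).
{ intros a. apply Forall_impl. intros x. apply H1. }
split; exists (fun x => x); (split; [split; [|split; [|split]]|]).
- intros x. apply H1.
- trivial.
- intros n a. rewrite map_id. apply H2.
- intros m a. rewrite map_id. apply H3.
- intros y Hy. exists y. split; [now apply H1|reflexivity].
- intros x. apply H1.
- trivial.
- intros n a [K1 [K2 K3]]. rewrite map_id. symmetry. apply H2.
  repeat split; auto.
- intros m a [K1 [K2 K3]]. rewrite map_id. symmetry. apply H3.
  repeat split; auto.
- intros y Hy. exists y. split; [now apply H1|reflexivity].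
Qed.

Lemma canonical_age_represents L (M : structure L nat) (K : computable_age L) :
  canonical_age M K ->
  forall T (B : structure L T),
    in_age (age_of K) B <->
    exists a, Forall (dom M) a /\ isomorphic (cl_structure M a) B.
Proof.
intros [_ [H1 [H2 H3]]] T B. split.
- intros [i Hi]. exists (gens K i). split; [apply H1|].
  apply (isomorphic_trans (proj2 (same_structure_iso (H3 i))) Hi).
- intros [a [Ha Hi]]. destruct (H2 a Ha 0) as [i [_ <-]]. exists i.
  apply (isomorphic_trans (proj1 (same_structure_iso (H3 i))) Hi).
Qed.

(* Main.v *)
(** The structure is a directed graph. Its spine is the path
    ... -> 2 -> 1 -> 0, with loops at all vertices but 0, so that any embedded
    copy of an initial segment of it is the segment itself. Every [k] on the
    spine has two further neighbours, its sides, which are exchanged by an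
    automorphism unless program [k] halts on input [k]; if it halts, a mark is
    attached to one of them, and the mark is a natural number above the halting
    time. An embedding of the ball of all vertices up to level [n] exchanges at
    most some unmarked pairs of sides, hence extends to an automorphism; so
    balls are amalgamation bases, and (CAP) holds. Conversely, let an
    amalgamation base extend the segment up to [k + 1] together with one side of
    [k]. If [k] has a mark, the base contains it, because otherwise it has two
    extensions that mark its side and the opposite one. The largest number in
    any such base is therefore a bound for the halting time of [k], and an
    enumeration of distinguished extensions yields such a base. *)

From Stdlib Require Import Arith Cantor List Lia Bool ClassicalEpsilon.
Require Import Defs.
Import ListNotations.

Set Implicit Arguments.

(** * Inverse laws and bounds for the pairing function *)

Lemma nfst_npair x y : nfst (npair x y) = x.
Proof. unfold nfst, npair. now rewrite Cantor.cancel_of_to. Qed.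

Lemma nsnd_npair x y : nsnd (npair x y) = y.
Proof. unfold nsnd, npair. now rewrite Cantor.cancel_of_to. Qed.

Lemma npair_eta n : npair (nfst n) (nsnd n) = n.
Proof.
unfold nfst, nsnd, npair. rewrite <- surjective_pairing.
apply Cantor.cancel_to_of.
Qed.

Lemma npair_inj x y x' y' : npair x y = npair x' y' -> x = x' /\ y = y'.
Proof.
intros H. split.
- rewrite <- (nfst_npair x y), H. apply nfst_npair.
- rewrite <- (nsnd_npair x y), H. apply nsnd_npair.
Qed.

Lemma npair_ge_l x y : x <= npair x y.
Proof. pose proof (Cantor.to_nat_non_decreasing x y). unfold npair. lia. Qed.

Lemma npair_ge_r x y : y <= npair x y.
Proof. pose proof (Cantor.to_nat_non_decreasing x y). unfold npair. lia. Qed.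

Lemma nsnd_le n : nsnd n <= n.
Proof. rewrite <- (npair_eta n) at 2. apply npair_ge_r. Qed.

Global Opaque npair nfst nsnd.

Ltac pair_simpl := repeat rewrite ?nfst_npair, ?nsnd_npair.

(** * Recursive functions relative to an oracle *)

Definition computes (X : nat -> Prop) (c : code) (f : nat -> nat) : Prop :=
  forall x y, eval X c x y <-> y = f x.

Definition rec_in (X : nat -> Prop) (f : nat -> nat) : Prop :=
  exists c, computes X c f.

Definition dec_in (X : nat -> Prop) (p : nat -> bool) : Prop :=
  rec_in X (fun x => Nat.b2n (p x)).

Lemma rec_ext X f g : (forall x, f x = g x) -> rec_in X f -> rec_in X g.
Proof.
intros H [c Hc]. exists c. intros x y. rewrite <- H. apply Hc.
Qed.

Lemma rec_zero X : rec_in X (fun _ => 0).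
Proof. exists CZero. intros x y. reflexivity. Qed.

Lemma rec_comp X g f :
  rec_in X g -> rec_in X f -> rec_in X (fun x => g (f x)).
Proof.
intros [c Hc] [d Hd]. exists (CComp c d). intros x y. simpl. split.
- intros [u [Hu Hy]]. apply Hd in Hu. apply Hc in Hy. now subst.
- intros ->. exists (f x). split; [now apply Hd|now apply Hc].
Qed.

Lemma rec_S X f : rec_in X f -> rec_in X (fun x => S (f x)).
Proof.
apply (@rec_comp X S). exists CSucc. intros x y. reflexivity.
Qed.

Lemma rec_nfst X f : rec_in X f -> rec_in X (fun x => nfst (f x)).
Proof.
apply (@rec_comp X nfst). exists CFst. intros x y. reflexivity.
Qed.

Lemma rec_nsnd X f : rec_in X f -> rec_in X (fun x => nsnd (f x)).
Proof.
apply (@rec_comp X nsnd). exists CSnd. intros x y. reflexivity.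
Qed.

Lemma rec_npair X f g :
  rec_in X f -> rec_in X g -> rec_in X (fun x => npair (f x) (g x)).
Proof.
intros [c Hc] [d Hd]. exists (CPair c d). intros x y. simpl. split.
- intros [u [v [Hu [Hv ->]]]]. apply Hc in Hu. apply Hd in Hv. now subst.
- intros ->. exists (f x), (g x).
  split; [now apply Hc|]. split; [now apply Hd|reflexivity].
Qed.

(** There is no program for the identity; pairing the two projections gives the number back. *)
Lemma rec_id X : rec_in X (fun x => x).
Proof.
exists (CPair CFst CSnd). intros x y. simpl. split.
- intros [u [v [-> [-> ->]]]]. apply npair_eta.
- intros ->. exists (nfst x), (nsnd x). now rewrite npair_eta.
Qed.

Lemma rec_const X k : rec_in X (fun _ => k).
Proof.
induction k as [|k IH]; [apply rec_zero|]. now apply (@rec_S X (fun _ => k)).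
Qed.

(** [CPrec] takes its parameter and its counter from one packed argument. It is applied to
    [npair x (n x)], so that all of [x] stays available to the recursion step. *)
Lemma rec_nat_rect X g h n :
  rec_in X g -> rec_in X h -> rec_in X n ->
  rec_in X (fun x => nat_rect (fun _ => nat) (g x)
                       (fun k r => h (npair x (npair k r))) (n x)).
Proof.
intros [c Hc] [d Hd] Hn.
set (F := fun z => nat_rect (fun _ => nat) (g (nfst z))
                     (fun k r => h (npair (nfst z) (npair k r))) (nsnd z)).
assert (HF : rec_in X F).
{ exists (CPrec c d). intros z y. unfold F. simpl.
  revert y. induction (nsnd z) as [|k IH]; intros y; simpl; [apply Hc|].
  split.
  - intros [r [Hr Hy]]. apply IH in Hr. apply Hd in Hy. now subst.
  - intros ->. eexists. split; [apply IH; reflexivity|now apply Hd]. }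
apply (rec_ext (f := fun x => F (npair x (n x)))).
- intros x. unfold F. now pair_simpl.
- apply (rec_comp HF). apply rec_npair; [apply rec_id|exact Hn].
Qed.

Lemma rec_iter X n f g :
  rec_in X n -> rec_in X f -> rec_in X g ->
  rec_in X (fun x => Nat.iter (n x) f (g x)).
Proof.
intros Hn Hf Hg.
apply (rec_ext (f := fun x => nat_rect (fun _ => nat) (g x)
  (fun k r => (fun z => f (nsnd (nsnd z))) (npair x (npair k r))) (n x))).
- intros x. simpl. induction (n x) as [|k IH]; simpl; [reflexivity|].
  now rewrite IH; pair_simpl.
- apply (@rec_nat_rect X g (fun z => f (nsnd (nsnd z))) n); trivial.
  apply (rec_comp Hf). apply rec_nsnd, rec_nsnd, rec_id.
Qed.

Lemma rec_case X n f g :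
  rec_in X n -> rec_in X f -> rec_in X g ->
  rec_in X (fun x => match n x with 0 => f x | S _ => g x end).
Proof.
intros Hn Hf Hg.
apply (rec_ext (f := fun x => nat_rect (fun _ => nat) (f x)
  (fun k r => (fun z => g (nfst z)) (npair x (npair k r))) (n x))).
- intros x. simpl. destruct (n x); simpl; now pair_simpl.
- apply (@rec_nat_rect X f (fun z => g (nfst z)) n); trivial.
  apply (rec_comp Hg), rec_nfst, rec_id.
Qed.

Lemma rec_pred X f : rec_in X f -> rec_in X (fun x => pred (f x)).
Proof.
apply (@rec_comp X pred).
apply (rec_ext (f := fun x => nat_rect (fun _ => nat) ((fun _ => 0) x)
  (fun k r => (fun z => nfst (nsnd z)) (npair x (npair k r))) x)).
- intros [|x]; simpl; now pair_simpl.
- apply (@rec_nat_rect X (fun _ => 0) (fun z => nfst (nsnd z)) (fun x => x));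
    [apply rec_zero|apply rec_nfst, rec_nsnd, rec_id|].
  apply rec_id.
Qed.

Lemma rec_sub X f g :
  rec_in X f -> rec_in X g -> rec_in X (fun x => f x - g x).
Proof.
intros Hf Hg. apply (rec_ext (f := fun x => Nat.iter (g x) pred (f x))).
- intros x. induction (g x) as [|k IH]; simpl; [lia|]. rewrite IH. lia.
- apply rec_iter; trivial. apply rec_pred, rec_id.
Qed.

Lemma rec_if X p f g :
  dec_in X p -> rec_in X f -> rec_in X g ->
  rec_in X (fun x => if p x then f x else g x).
Proof.
intros Hp Hf Hg.
apply (rec_ext (f := fun x => match Nat.b2n (p x) with 0 => g x | S _ => f x end)).
- intros x. now destruct (p x).
- now apply rec_case.
Qed.

Lemma dec_const X b : dec_in X (fun _ => b).
Proof. apply (rec_const X (Nat.b2n b)). Qed.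

Lemma dec_if X p q r :
  dec_in X p -> dec_in X q -> dec_in X r ->
  dec_in X (fun x => if p x then q x else r x).
Proof.
intros Hp Hq Hr. eapply rec_ext; [|apply (rec_if Hp Hq Hr)].
intros x. simpl. now destruct (p x).
Qed.

Lemma dec_andb X p q :
  dec_in X p -> dec_in X q -> dec_in X (fun x => p x && q x).
Proof. intros Hp Hq. apply (dec_if Hp Hq (dec_const X false)). Qed.

Lemma dec_orb X p q :
  dec_in X p -> dec_in X q -> dec_in X (fun x => p x || q x).
Proof. intros Hp Hq. apply (dec_if Hp (dec_const X true) Hq). Qed.

Lemma dec_negb X p : dec_in X p -> dec_in X (fun x => negb (p x)).
Proof.
intros Hp. apply (dec_if Hp (dec_const X false) (dec_const X true)).
Qed.

Lemma dec_comp X p f :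
  dec_in X p -> rec_in X f -> dec_in X (fun x => p (f x)).
Proof. intros Hp Hf. apply (rec_comp Hp Hf). Qed.

Lemma dec_ext X p q : (forall x, p x = q x) -> dec_in X p -> dec_in X q.
Proof. intros H. apply rec_ext. intros x. now rewrite H. Qed.

Lemma dec_eqb X f g :
  rec_in X f -> rec_in X g -> dec_in X (fun x => f x =? g x).
Proof.
intros Hf Hg.
assert (Z : forall n, rec_in X n ->
  dec_in X (fun x => match n x with 0 => true | S _ => false end)).
{ intros n Hn.
  eapply rec_ext; [|apply (rec_case Hn (rec_const X 1) (rec_const X 0))].
  intros x. simpl. now destruct (n x). }
eapply dec_ext;
  [|apply (dec_andb (Z _ (rec_sub Hf Hg)) (Z _ (rec_sub Hg Hf)))].
intros x. simpl. destruct (Nat.eqb_spec (f x) (g x)) as [->|N].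
- now rewrite Nat.sub_diag.
- destruct (f x - g x) eqn:H1, (g x - f x) eqn:H2; trivial; lia.
Qed.

(** The test of the search does not look at the candidate, so the search stops at 0 or never. *)
Lemma semidecidable X p : dec_in X p ->
  exists c, forall x, (exists y, eval X c x y) <-> p x = true.
Proof.
intros Hp.
assert (H : rec_in X (fun z => Nat.b2n (negb (p (nfst z))))).
{ apply dec_negb, (dec_comp Hp), rec_nfst, rec_id. }
destruct H as [c Hc]. exists (CMu c). intros x. split.
- intros [y [Hy _]]. apply Hc in Hy. rewrite nfst_npair in Hy.
  now destruct (p x).
- intros Hx. exists 0. split; [|intros z; lia].
  apply Hc. rewrite nfst_npair. now rewrite Hx.
Qed.

Ltac solve_rec :=
  repeat (assumption ||
  lazymatch goal with
  | |- rec_in _ (fun x => x) => apply rec_id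
  | |- rec_in _ (fun _ => ?k) => apply rec_const
  | |- rec_in _ nfst => apply (@rec_nfst _ (fun x => x))
  | |- rec_in _ nsnd => apply (@rec_nsnd _ (fun x => x))
  | |- dec_in _ (fun _ => ?k) => apply dec_const
  | |- rec_in _ (fun x => S (@?f x)) => apply (@rec_S _ f)
  | |- rec_in _ (fun x => pred (@?f x)) => apply (@rec_pred _ f)
  | |- rec_in _ (fun x => nfst (@?f x)) => apply (@rec_nfst _ f)
  | |- rec_in _ (fun x => nsnd (@?f x)) => apply (@rec_nsnd _ f)
  | |- rec_in _ (fun x => npair (@?f x) (@?g x)) => apply (@rec_npair _ f g)
  | |- rec_in _ (fun x => if @?p x then @?f x else @?g x) =>
      apply (@rec_if _ p f g)
  | |- dec_in _ (fun x => if @?p x then @?f x else @?g x) =>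
      apply (@dec_if _ p f g)
  | |- dec_in _ (fun x => @?p x && @?q x) => apply (@dec_andb _ p q)
  | |- dec_in _ (fun x => @?p x || @?q x) => apply (@dec_orb _ p q)
  | |- dec_in _ (fun x => negb (@?p x)) => apply (@dec_negb _ p)
  | |- dec_in _ (fun x => @?f x =? @?g x) => apply (@dec_eqb _ f g)
  | H : rec_in _ ?h |- rec_in _ (fun x => ?h (@?f x)) =>
      apply (@rec_comp _ h f H)
  | H : dec_in _ ?h |- dec_in _ (fun x => ?h (@?f x)) =>
      apply (@dec_comp _ h f H)
  end).

Lemma code_num_inj c d : code_num c = code_num d -> c = d.
Proof.
revert d. induction c; intros []; simpl; intros H;
  apply npair_inj in H as [H1 H2]; try discriminate; trivial.
all: try (apply npair_inj in H2 as [H2 H3]).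
all: f_equal; auto.
Qed.

Lemma phi_code_num X c x y : phi X (code_num c) x y <-> eval X c x y.
Proof.
split.
- intros [d [Hd H]]. apply code_num_inj in Hd. now subst.
- intros H. now exists c.
Qed.

(** * A universal machine *)

(** A state is a pair (stack, value).  A frame of the stack is either the
    number of a program, to be applied to the value (tags 0 to 8), or the
    continuation of a pairing, recursion or search (tags 9 to 12), or the
    request to check that a number is the number of a program (tag 13). *)
Definition push (f K : nat) : nat := S (npair f K).

Definition pair1_frame (d x : nat) : nat := npair 9 (npair d x).
Definition pair2_frame (u : nat) : nat := npair 10 u.
(** [j] iterations are left after [k] of them. *)
Definition prec_frame (d a k j : nat) : nat :=
  npair 11 (npair d (npair a (npair k j))).
Definition mu_frame (c x z : nat) : nat := npair 12 (npair c (npair x z)).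
Definition check_frame (c : nat) : nat := npair 13 c.

(** States with empty stack are fixed, which makes halting monotone in the number of steps. A failed
    check is fixed too, but with nonempty stack, so it amounts to running forever. *)
Definition step (chi : nat -> nat) (s : nat) : nat :=
  let v := nsnd s in
  let K := nsnd (pred (nfst s)) in
  let f := nfst (pred (nfst s)) in
  let t := nfst f in
  let d := nsnd f in
  if nfst s =? 0 then s
  else if t =? 0 then npair K 0
  else if t =? 1 then npair K (S v)
  else if t =? 2 then npair K (nfst v)
  else if t =? 3 then npair K (nsnd v)
  else if t =? 4 then npair K (chi v)
  else if t =? 5 then
    npair (push (nfst d) (push (pair1_frame (nsnd d) v) K)) v
  else if t =? 6 then npair (push (nsnd d) (push (nfst d) K)) v
  else if t =? 7 then
    npair (push (nfst d) (push (prec_frame (nsnd d) (nfst v) 0 (nsnd v)) K))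
      (nfst v)
  else if t =? 8 then npair (push d (push (mu_frame d v 0) K)) (npair v 0)
  else if t =? 9 then
    npair (push (nfst d) (push (pair2_frame v) K)) (nsnd d)
  else if t =? 10 then npair K (npair d v)
  else if t =? 11 then
    let c := nfst d in
    let a := nfst (nsnd d) in
    let k := nfst (nsnd (nsnd d)) in
    let j := nsnd (nsnd (nsnd d)) in
    if j =? 0 then npair K v
    else npair (push c (push (prec_frame c a (S k) (pred j)) K))
           (npair a (npair k v))
  else if t =? 12 then
    let c := nfst d in
    let x := nfst (nsnd d) in
    let z := nsnd (nsnd d) in
    if v =? 0 then npair K z
    else npair (push c (push (mu_frame c x (S z)) K)) (npair x (S z))
  else
    let e := nsnd d in
    if (nfst d =? 0) || (nfst d =? 1) || (nfst d =? 2) || (nfst d =? 3)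
       || (nfst d =? 4)
    then if e =? 0 then npair K v else s
    else if (nfst d =? 5) || (nfst d =? 6) || (nfst d =? 7) then
      npair (push (check_frame (nfst e)) (push (check_frame (nsnd e)) K)) v
    else if nfst d =? 8 then npair (push (check_frame e) K) v
    else s.

Definition halts_in (chi : nat -> nat) (n s : nat) : Prop :=
  nfst (Nat.iter n (step chi) s) = 0.

Lemma rec_step X chi : rec_in X chi -> rec_in X (step chi).
Proof.
intros H. unfold step, push, pair1_frame, pair2_frame, prec_frame, mu_frame,
  check_frame. cbv zeta. solve_rec.
Qed.

Lemma halts_in_S chi n s : halts_in chi (S n) s <-> halts_in chi n (step chi s).
Proof. unfold halts_in. now rewrite Nat.iter_succ_r. Qed.

Lemma halts_in_0 chi f K v : ~ halts_in chi 0 (npair (push f K) v).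
Proof. unfold halts_in, push. simpl. pair_simpl. discriminate. Qed.

Lemma halts_in_mono chi n m s : n <= m -> halts_in chi n s -> halts_in chi m s.
Proof.
induction 1 as [|m _ IH]; trivial. intros H. specialize (IH H).
unfold halts_in in *. simpl. unfold step at 1. now rewrite IH.
Qed.

Lemma halts_in_stuck chi s :
  step chi s = s -> nfst s <> 0 -> forall n, ~ halts_in chi n s.
Proof.
intros Hs H n. unfold halts_in.
replace (Nat.iter n (step chi) s) with s; trivial.
induction n as [|n IH]; trivial. simpl. now rewrite <- IH.
Qed.

Ltac step_simpl :=
  unfold step, push, pair1_frame, pair2_frame, prec_frame, mu_frame,
    check_frame; cbv zeta; simpl code_num; pair_simpl; simpl Nat.pred;
  pair_simpl; simpl; pair_simpl.

Lemma halts_in_push chi n f K v :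
  halts_in chi n (npair (push f K) v) ->
  exists m, n = S m /\ halts_in chi m (step chi (npair (push f K) v)).
Proof.
destruct n as [|n]; intros H.
- now apply halts_in_0 in H.
- exists n. split; trivial. now apply halts_in_S.
Qed.

Lemma step_zero chi K v :
  step chi (npair (push (code_num CZero) K) v) = npair K 0.
Proof. now step_simpl. Qed.

Lemma step_succ chi K v :
  step chi (npair (push (code_num CSucc) K) v) = npair K (S v).
Proof. now step_simpl. Qed.

Lemma step_fst chi K v :
  step chi (npair (push (code_num CFst) K) v) = npair K (nfst v).
Proof. now step_simpl. Qed.

Lemma step_snd chi K v :
  step chi (npair (push (code_num CSnd) K) v) = npair K (nsnd v).
Proof. now step_simpl. Qed.

Lemma step_oracle chi K v :
  step chi (npair (push (code_num COracle) K) v) = npair K (chi v).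
Proof. now step_simpl. Qed.

Lemma step_pair chi c d K v :
  step chi (npair (push (code_num (CPair c d)) K) v) =
  npair (push (code_num c) (push (pair1_frame (code_num d) v) K)) v.
Proof. now step_simpl. Qed.

Lemma step_comp chi c d K v :
  step chi (npair (push (code_num (CComp c d)) K) v) =
  npair (push (code_num d) (push (code_num c) K)) v.
Proof. now step_simpl. Qed.

Lemma step_prec chi c d K v :
  step chi (npair (push (code_num (CPrec c d)) K) v) =
  npair (push (code_num c)
    (push (prec_frame (code_num d) (nfst v) 0 (nsnd v)) K)) (nfst v).
Proof. now step_simpl. Qed.

Lemma step_mu chi c K v :
  step chi (npair (push (code_num (CMu c)) K) v) =
  npair (push (code_num c) (push (mu_frame (code_num c) v 0) K)) (npair v 0).
Proof. now step_simpl. Qed.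

Lemma step_pair1 chi d x K u :
  step chi (npair (push (pair1_frame d x) K) u) =
  npair (push d (push (pair2_frame u) K)) x.
Proof. now step_simpl. Qed.

Lemma step_pair2 chi u K v :
  step chi (npair (push (pair2_frame u) K) v) = npair K (npair u v).
Proof. now step_simpl. Qed.

Lemma step_prec0 chi d a k K v :
  step chi (npair (push (prec_frame d a k 0) K) v) = npair K v.
Proof. now step_simpl. Qed.

Lemma step_precS chi d a k j K v :
  step chi (npair (push (prec_frame d a k (S j)) K) v) =
  npair (push d (push (prec_frame d a (S k) j) K)) (npair a (npair k v)).
Proof. now step_simpl. Qed.

Lemma step_mu0 chi c x z K :
  step chi (npair (push (mu_frame c x z) K) 0) = npair K z.
Proof. now step_simpl. Qed.

Lemma step_muS chi c x z K v :
  step chi (npair (push (mu_frame c x z) K) (S v)) =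
  npair (push c (push (mu_frame c x (S z)) K)) (npair x (S z)).
Proof. now step_simpl. Qed.

Lemma step_check_atom chi t K v : t < 5 ->
  step chi (npair (push (check_frame (npair t 0)) K) v) = npair K v.
Proof.
intros H. do 5 (destruct t as [|t]; [now step_simpl|]). lia.
Qed.

Lemma step_check_binary chi t c d K v : 5 <= t < 8 ->
  step chi (npair (push (check_frame (npair t (npair c d))) K) v) =
  npair (push (check_frame c) (push (check_frame d) K)) v.
Proof.
intros H. do 5 (destruct t as [|t]; [lia|]).
do 3 (destruct t as [|t]; [now step_simpl|]). lia.
Qed.

Lemma step_check_unary chi c K v :
  step chi (npair (push (check_frame (npair 8 c)) K) v) =
  npair (push (check_frame c) K) v.
Proof. now step_simpl. Qed.

(** Such numbers belong to no program: atoms have second component 0, and the tags end at 8. *)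
Lemma step_check_stuck chi t e K v : t < 5 /\ e <> 0 \/ 8 < t ->
  step chi (npair (push (check_frame (npair t e)) K) v) =
  npair (push (check_frame (npair t e)) K) v.
Proof.
intros [[H He]|H].
- apply Nat.eqb_neq in He.
  do 5 (destruct t as [|t]; [step_simpl; now rewrite He|]). lia.
- do 9 (destruct t as [|t]; [lia|]). now step_simpl.
Qed.

(** * Correctness of the universal machine *)

Definition char_fun (X : nat -> Prop) (chi : nat -> nat) : Prop :=
  forall x, (X x /\ chi x = 1) \/ (~ X x /\ chi x = 0).

Lemma char_fun_exists X : exists chi, char_fun X chi.
Proof.
exists (fun x => if excluded_middle_informative (X x) then 1 else 0).
intros x. destruct (excluded_middle_informative (X x)); auto.
Qed.

Lemma rec_char_fun X chi : char_fun X chi -> rec_in X chi.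
Proof.
intros H. exists COracle. intros x y. simpl.
destruct (H x) as [[H1 H2]|[H1 H2]]; rewrite H2; tauto.
Qed.

(** In continuation style: a halting run of the rest [K] of the stack is prolonged by a successful
    check. The two checks of a binary program are then treated one after the other. *)
Lemma check_complete chi c n K v : halts_in chi n (npair K v) ->
  exists m, halts_in chi m (npair (push (check_frame (code_num c)) K) v).
Proof.
revert n K.
assert (A : forall t n K, t < 5 -> halts_in chi n (npair K v) ->
  exists m, halts_in chi m (npair (push (check_frame (npair t 0)) K) v)).
{ intros t n K Ht H. exists (S n). apply halts_in_S.
  now rewrite step_check_atom. }
assert (B : forall t c d n K, 5 <= t < 8 ->
  halts_in chi n (npair (push (check_frame c) (push (check_frame d) K)) v) ->
  exists m,
    halts_in chi m (npair (push (check_frame (npair t (npair c d))) K) v)).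
{ intros t a b n K Ht H. exists (S n). apply halts_in_S.
  now rewrite step_check_binary. }
induction c as [| | | | |c IHc d IHd|c IHc d IHd|c IHc d IHd|c IHc];
  intros n K H; simpl.
1-5: apply (A _ n); [lia|exact H].
1-3: destruct (IHd n K H) as [m Hm]; destruct (IHc m _ Hm) as [p Hp];
  apply (B _ _ _ p); [lia|exact Hp].
destruct (IHc n K H) as [m Hm]. exists (S m). apply halts_in_S.
now rewrite step_check_unary.
Qed.

(** As [e] is an arbitrary number, the induction is on the number of steps; the bound [m < n] lets
    the second check of a binary program fall under the induction hypothesis. *)
Lemma check_sound chi n : forall e K v,
  halts_in chi n (npair (push (check_frame e) K) v) ->
  exists c m, code_num c = e /\ m < n /\ halts_in chi m (npair K v).
Proof.
induction n as [n IH] using lt_wf_ind. intros e K v H.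
rewrite <- (npair_eta e) in *.
assert (NS : ~ (nfst e < 5 /\ nsnd e <> 0 \/ 8 < nfst e)).
{ intros Hs. revert H. apply halts_in_stuck; [now apply step_check_stuck|].
  unfold push. now pair_simpl. }
apply halts_in_push in H as [m [-> H]].
destruct (Nat.lt_ge_cases (nfst e) 5) as [L|L].
- assert (nsnd e = 0) as E by lia. rewrite E in *.
  rewrite step_check_atom in H by exact L.
  assert (C : exists c, code_num c = npair (nfst e) 0).
  { destruct (nfst e) as [|[|[|[|[|t]]]]];
      [now exists CZero|now exists CSucc|now exists CFst|now exists CSnd
      |now exists COracle|lia]. }
  destruct C as [c Hc]. exists c, m. auto.
- destruct (Nat.lt_ge_cases (nfst e) 8) as [L'|L'].
  + rewrite <- (npair_eta (nsnd e)) in *.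
    rewrite step_check_binary in H by lia.
    apply IH in H as [c [p [Hc [Hp H]]]]; [|lia].
    apply IH in H as [d [q [Hd [Hq H]]]]; [|lia].
    assert (C : exists b, code_num b = npair (nfst e)
                            (npair (nfst (nsnd e)) (nsnd (nsnd e)))).
    { rewrite <- Hc, <- Hd. assert (nfst e = 5 \/ nfst e = 6 \/ nfst e = 7)
        as [-> | [-> | ->]] by lia.
      - now exists (CPair c d).
      - now exists (CComp c d).
      - now exists (CPrec c d). }
    destruct C as [b Hb]. exists b, q. split; [exact Hb|]. split; [lia|auto].
  + assert (nfst e = 8) as E by lia. rewrite E in *.
    rewrite step_check_unary in H.
    apply IH in H as [c [p [Hc [Hp H]]]]; [|lia].
    exists (CMu c), p. simpl. rewrite Hc. split; [reflexivity|].
    split; [lia|auto].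
Qed.

(** Again in continuation style: a halting run of [K] on the output is prolonged backwards through
    the computation of [c]. *)
Lemma run_complete X chi : char_fun X chi -> forall c x y n K,
  eval X c x y -> halts_in chi n (npair K y) ->
  exists m, halts_in chi m (npair (push (code_num c) K) x).
Proof.
intros HX c.
assert (S1 : forall n s, halts_in chi n (step chi s) ->
                         exists m, halts_in chi m s).
{ intros n s H. exists (S n). now apply halts_in_S. }
induction c as [| | | | |c IHc d IHd|c IHc d IHd|c IHc d IHd|c IHc];
  intros x y n K He Hn.
- simpl in He. subst. apply (S1 n). now rewrite step_zero.
- simpl in He. subst. apply (S1 n). now rewrite step_succ.
- simpl in He. subst. apply (S1 n). now rewrite step_fst.
- simpl in He. subst. apply (S1 n). now rewrite step_snd.
- simpl in He. apply (S1 n). rewrite step_oracle.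
  destruct (HX x) as [[H1 ->] | [H1 ->]], He as [[H2 ->] | [H2 ->]]; tauto.
- destruct He as [u [v [Hu [Hv ->]]]].
  destruct (S1 n (npair (push (pair2_frame u) K) v)) as [n1 H1];
    [now rewrite step_pair2|].
  destruct (IHd _ _ _ _ Hv H1) as [n2 H2].
  destruct (S1 n2 (npair (push (pair1_frame (code_num d) x) K) u))
    as [n3 H3]; [now rewrite step_pair1|].
  destruct (IHc _ _ _ _ Hu H3) as [n4 H4].
  apply (S1 n4). now rewrite step_pair.
- destruct He as [u [Hu Hy]].
  destruct (IHc _ _ _ _ Hy Hn) as [n1 H1].
  destruct (IHd _ _ _ _ Hu H1) as [n2 H2].
  apply (S1 n2). now rewrite step_comp.
(* If the machine halts from the state with [k] iterations done and [j] left, it halts from the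
   start of the recursion; the induction undoes the iterations one by one. *)
- assert (P : forall k j r,
    nat_rect (fun _ => nat -> Prop) (fun y => eval X c (nfst x) y)
      (fun k R y => exists r, R r /\ eval X d (npair (nfst x) (npair k r)) y)
      k r ->
    (exists m, halts_in chi m
       (npair (push (prec_frame (code_num d) (nfst x) k j) K) r)) ->
    exists m, halts_in chi m (npair (push (code_num c)
       (push (prec_frame (code_num d) (nfst x) 0 (k + j)) K)) (nfst x))).
  { induction k as [|k IH]; intros j r Hr [m Hm].
    - exact (IHc _ _ _ _ Hr Hm).
    - destruct Hr as [r' [Hr' Hr]].
      destruct (IHd _ _ _ _ Hr Hm) as [m' Hm'].
      replace (S k + j) with (k + S j) by lia. apply (IH _ r' Hr').
      apply (S1 m'). now rewrite step_precS. }
  destruct (P (nsnd x) 0 y He) as [m Hm].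
  { apply (S1 n). now rewrite step_prec0. }
  apply (S1 m). rewrite step_prec. now rewrite Nat.add_0_r in Hm.
- destruct He as [H0 Hlt].
  (* [j] is the distance from the candidate [z] to the result [y], so the search is traversed from
     its end. *)
  assert (P : forall j z, z + j = y -> exists m, halts_in chi m
    (npair (push (code_num c) (push (mu_frame (code_num c) x z) K))
       (npair x z))).
  { induction j as [|j IH]; intros z Hz.
    - replace z with y by lia. apply (IHc _ 0 (S n) _ H0).
      apply halts_in_S. now rewrite step_mu0.
    - destruct (Hlt z) as [v Hv]; [lia|].
      destruct (IH (S z)) as [m Hm]; [lia|].
      apply (IHc _ (S v) (S m) _ Hv). apply halts_in_S. now rewrite step_muS. }
  destruct (P y 0 eq_refl) as [m Hm]. apply (S1 m). now rewrite step_mu.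
Qed.

Lemma run_sound X chi : char_fun X chi -> forall c n x K,
  halts_in chi n (npair (push (code_num c) K) x) ->
  exists y m, eval X c x y /\ m < n /\ halts_in chi m (npair K y).
Proof.
intros HX c.
induction c as [| | | | |c IHc d IHd|c IHc d IHd|c IHc d IHd|c IHc];
  intros n x K H; apply halts_in_push in H as [n1 [-> H]].
- rewrite step_zero in H. exists 0, n1. simpl. auto.
- rewrite step_succ in H. exists (S x), n1. simpl. auto.
- rewrite step_fst in H. exists (nfst x), n1. simpl. auto.
- rewrite step_snd in H. exists (nsnd x), n1. simpl. auto.
- rewrite step_oracle in H. exists (chi x), n1. simpl.
  split; [|auto]. destruct (HX x) as [[H1 H2]|[H1 H2]]; auto.
- rewrite step_pair in H.
  apply IHc in H as [u [n2 [Hu [L2 H]]]].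
  apply halts_in_push in H as [n3 [-> H]]. rewrite step_pair1 in H.
  apply IHd in H as [v [n4 [Hv [L4 H]]]].
  apply halts_in_push in H as [n5 [-> H]]. rewrite step_pair2 in H.
  exists (npair u v), n5. split; [simpl; eauto 6|]. split; [lia|exact H].
- rewrite step_comp in H.
  apply IHd in H as [u [n2 [Hu [L2 H]]]].
  apply IHc in H as [y [n3 [Hy [L3 H]]]].
  exists y, n3. split; [simpl; eauto|]. split; [lia|exact H].
- rewrite step_prec in H.
  assert (P : forall j k r n,
    nat_rect (fun _ => nat -> Prop) (fun y => eval X c (nfst x) y)
      (fun k R y => exists r, R r /\ eval X d (npair (nfst x) (npair k r)) y)
      k r ->
    halts_in chi n
       (npair (push (prec_frame (code_num d) (nfst x) k j) K) r) ->
    exists y m, nat_rect (fun _ => nat -> Prop)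
      (fun y => eval X c (nfst x) y)
      (fun k R y => exists r, R r /\ eval X d (npair (nfst x) (npair k r)) y)
      (k + j) y /\ m < n /\ halts_in chi m (npair K y)).
  { induction j as [|j IH]; intros k r n Hr H1;
      apply halts_in_push in H1 as [n2 [-> H1]].
    - rewrite step_prec0 in H1. rewrite Nat.add_0_r. exists r, n2. auto.
    - rewrite step_precS in H1.
      apply IHd in H1 as [y [n3 [Hy [L3 H1]]]].
      apply IH in H1 as [z [n4 [Hz [L4 H1]]]]; [|simpl; eauto].
      exists z, n4. rewrite Nat.add_succ_r. split; [exact Hz|].
      split; [lia|exact H1]. }
  apply IHc in H as [r [n2 [Hr [L2 H]]]].
  apply (P _ 0 _ _ Hr) in H as [y [m [Hy [Hm H]]]].
  exists y, m. split; [exact Hy|]. split; [lia|exact H].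
- rewrite step_mu in H.
  (* The number of iterations of a search is not known in advance; the length of the halting run
     serves as the measure. *)
  assert (P : forall n z,
    (forall i, i < z -> exists v, eval X c (npair x i) (S v)) ->
    halts_in chi n (npair (push (code_num c)
      (push (mu_frame (code_num c) x z) K)) (npair x z)) ->
    exists y m, eval X (CMu c) x y /\ m < n /\ halts_in chi m (npair K y)).
  { induction n as [n IH] using lt_wf_ind. intros z Hz H1.
    apply IHc in H1 as [v [n2 [Hv [L2 H1]]]].
    apply halts_in_push in H1 as [n3 [-> H1]].
    destruct v as [|v].
    - rewrite step_mu0 in H1. exists z, n3. split; [split; trivial|].
      split; [lia|exact H1].
    - rewrite step_muS in H1. apply IH in H1 as [y [m [Hy [Hm H1]]]]; [|lia|].
      + exists y, m. split; [exact Hy|]. split; [lia|exact H1].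
      + intros i Hi. destruct (Nat.eq_dec i z) as [->|N]; [eauto|].
        apply Hz. lia. }
  apply P in H as [y [m [Hy [Hm H]]]]; [|intros; lia].
  exists y, m. split; [exact Hy|]. split; [lia|exact H].
Qed.

(** The check comes first because [step] ignores malformed parts of a number and could halt where
    [phi] is undefined. *)
Definition init (e x : nat) : nat :=
  npair (push (check_frame e) (push e 0)) x.

Definition haltsb (chi : nat -> nat) (e x n : nat) : bool :=
  nfst (Nat.iter n (step chi) (init e x)) =? 0.

Lemma haltsb_W X chi e x : char_fun X chi ->
  (W X e x <-> exists n, haltsb chi e x n = true).
Proof.
intros HX. unfold haltsb. split.
- intros [y [c [<- H]]].
  destruct (@run_complete X chi HX c x y 0 0) as [m Hm]; trivial.
  { unfold halts_in. simpl. now pair_simpl. }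
  destruct (@check_complete chi c m _ _ Hm) as [k Hk].
  exists k. now apply Nat.eqb_eq.
- intros [n H]. apply Nat.eqb_eq in H.
  apply check_sound in H as [c [m [<- [_ H]]]].
  apply (run_sound HX) in H as [y [_ [H _]]]. exists y. now exists c.
Qed.

Lemma haltsb_mono chi e x n m :
  n <= m -> haltsb chi e x n = true -> haltsb chi e x m = true.
Proof.
unfold haltsb. intros L H. apply Nat.eqb_eq in H. apply Nat.eqb_eq.
now apply (halts_in_mono L).
Qed.

Lemma haltsb_0 chi e x : haltsb chi e x 0 = false.
Proof. unfold haltsb, init, push. simpl. now pair_simpl. Qed.

Lemma dec_haltsb X chi f g h :
  rec_in X chi -> rec_in X f -> rec_in X g -> rec_in X h ->
  dec_in X (fun z => haltsb chi (f z) (g z) (h z)).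
Proof.
intros H Hf Hg Hh. unfold haltsb, init, push, check_frame.
apply (dec_eqb (g := fun _ => 0)); [|apply rec_const].
apply (@rec_nfst X (fun z => Nat.iter (h z) (step chi)
  (npair (S (npair (npair 13 (f z)) (S (npair (f z) 0)))) (g z)))).
apply rec_iter; [exact Hh|now apply rec_step|solve_rec].
Qed.

Global Opaque haltsb.

(** * Coded lists and hardwired parameters *)

(** The code of a tail is smaller than the code of the list, so the code itself is enough fuel. *)
Fixpoint list_dec_fuel (fuel n : nat) : list nat :=
  match fuel, n with
  | S fuel', S m => nfst m :: list_dec_fuel fuel' (nsnd m)
  | _, _ => []
  end.

Definition list_dec (n : nat) : list nat := list_dec_fuel n n.

Lemma list_code_dec n : list_code (list_dec n) = n.
Proof.
unfold list_dec. enough (H : forall f m, m <= f ->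
  list_code (list_dec_fuel f m) = m) by now apply H.
induction f as [|f IH]; intros [|m] Hm; simpl; trivial; [lia|].
rewrite IH, npair_eta; trivial. pose proof (nsnd_le m). lia.
Qed.

Lemma list_code_inj a b : list_code a = list_code b -> a = b.
Proof.
revert b. induction a as [|x a IH]; intros [|y b] H; simpl in H; trivial;
  try discriminate.
injection H as H. apply npair_inj in H as [-> H]. f_equal. auto.
Qed.

Lemma list_dec_code a : list_dec (list_code a) = a.
Proof. apply list_code_inj, list_code_dec. Qed.

Lemma list_code_ge a x : In x a -> x < list_code a.
Proof.
induction a as [|y a IH]; simpl; [tauto|].
pose proof (npair_ge_l y (list_code a)). pose proof (npair_ge_r y (list_code a)).
intros [->|H1]; [lia|]. specialize (IH H1). lia.
Qed.

(** A step [F] on triples (parameter, rest of the list, accumulator) is iterated as often as the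
    code of the list says. That is at least its length, and a triple with empty rest is fixed. *)
Lemma rec_fold_left X g a l s :
  rec_in X g -> rec_in X a -> rec_in X l -> rec_in X s ->
  rec_in X (fun x => fold_left (fun acc y => g (npair (a x) (npair y acc)))
                       (list_dec (l x)) (s x)).
Proof.
intros Hg Ha Hl Hs.
set (F := fun z => if nfst (nsnd z) =? 0 then z else
  npair (nfst z) (npair (nsnd (pred (nfst (nsnd z))))
    (g (npair (nfst z) (npair (nfst (pred (nfst (nsnd z))))
                               (nsnd (nsnd z))))))).
assert (HF : forall p b n s, list_code b <= n ->
  nsnd (nsnd (Nat.iter n F (npair p (npair (list_code b) s)))) =
  fold_left (fun acc y => g (npair p (npair y acc))) b s).
{ intros p b. induction b as [|y b IH]; intros n t Hn; simpl.
  - replace (Nat.iter n F (npair p (npair 0 t))) with (npair p (npair 0 t)).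
    + now pair_simpl.
    + clear Hn. induction n as [|n IHn]; trivial. simpl. rewrite <- IHn.
      unfold F. now pair_simpl.
  - simpl in Hn. destruct n as [|n]; [lia|]. rewrite Nat.iter_succ_r.
    rewrite <- IH with (n := n).
    + do 2 f_equal. f_equal. unfold F. pair_simpl. simpl. now pair_simpl.
    + pose proof (npair_ge_r y (list_code b)). lia. }
apply (rec_ext (f := fun x => nsnd (nsnd (Nat.iter (l x) F
                       (npair (a x) (npair (l x) (s x))))))).
- intros x. rewrite <- (list_code_dec (l x)) at 2. apply HF.
  now rewrite list_code_dec.
- apply rec_nsnd, rec_nsnd. apply rec_iter; trivial.
  + unfold F. solve_rec.
  + solve_rec.
Qed.

Definition memb (x : nat) (l : list nat) : bool := existsb (Nat.eqb x) l.

Lemma memb_In x l : memb x l = true <-> In x l.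
Proof.
unfold memb. rewrite existsb_exists. split.
- intros [y [H E]]. apply Nat.eqb_eq in E. now subst.
- intros H. exists x. now rewrite Nat.eqb_refl.
Qed.

Lemma dec_memb X f l : rec_in X f -> rec_in X l ->
  dec_in X (fun x => memb (f x) (list_dec (l x))).
Proof.
intros Hf Hl.
set (g := fun z => if nfst z =? nfst (nsnd z) then 1 else nsnd (nsnd z)).
assert (Hg : rec_in X g) by (unfold g; solve_rec).
eapply rec_ext; [|apply (rec_fold_left Hg Hf Hl (rec_const X 0))].
intros x. simpl. unfold g.
assert (H : forall b, fold_left (fun acc y =>
    if nfst (npair (f x) (npair y acc)) =? nfst (nsnd (npair (f x) (npair y acc)))
    then 1 else nsnd (nsnd (npair (f x) (npair y acc))))
    (list_dec (l x)) (Nat.b2n b) = Nat.b2n (b || memb (f x) (list_dec (l x)))).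
{ induction (list_dec (l x)) as [|y a IH]; intros b; simpl.
  - now rewrite orb_false_r.
  - pair_simpl. unfold memb in *. destruct (f x =? y).
    + etransitivity; [apply (IH true)|]. now destruct b.
    + apply IH. }
apply (H false).
Qed.

Lemma dec_forallb X p l : dec_in X p -> rec_in X l ->
  dec_in X (fun x => forallb p (list_dec (l x))).
Proof.
intros Hp Hl.
set (g := fun z => if p (nfst (nsnd z)) then nsnd (nsnd z) else 0).
assert (Hg : rec_in X g) by (unfold g; solve_rec).
eapply rec_ext;
  [|apply (rec_fold_left Hg (rec_const X 0) Hl (rec_const X 1))].
intros x. simpl. unfold g.
assert (H : forall b, fold_left (fun acc y =>
    if p (nfst (nsnd (npair 0 (npair y acc))))
    then nsnd (nsnd (npair 0 (npair y acc))) else 0)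
    (list_dec (l x)) (Nat.b2n b) = Nat.b2n (b && forallb p (list_dec (l x)))).
{ induction (list_dec (l x)) as [|y a IH]; intros b; simpl.
  - now rewrite andb_true_r.
  - pair_simpl. destruct (p y).
    + apply IH.
    + etransitivity; [apply (IH false)|]. now destruct b. }
apply (H true).
Qed.

Definition const_code (n : nat) : code := Nat.iter n (CComp CSucc) CZero.

(** The s-m-n construction; [CPair CFst CSnd] is the identity. *)
Definition hardwire (c : code) (i : nat) : code :=
  CComp c (CPair (const_code i) (CPair CFst CSnd)).

Lemma eval_const_code X n x y : eval X (const_code n) x y <-> y = n.
Proof.
revert y. induction n as [|n IH]; intros y; simpl; [reflexivity|]. split.
- intros [u [Hu ->]]. apply IH in Hu. now subst.
- intros ->. exists n. split; [now apply IH|reflexivity].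
Qed.

Lemma eval_hardwire X c i x y :
  eval X (hardwire c i) x y <-> eval X c (npair i x) y.
Proof.
simpl. split.
- intros [u [[v [w [Hv [[p [q [-> [-> ->]]]] ->]]]] H]].
  apply eval_const_code in Hv. subst. now rewrite npair_eta in H.
- intros H. exists (npair i x). split; [|exact H].
  exists i, x. rewrite eval_const_code. split; [reflexivity|].
  split; [|reflexivity]. exists (nfst x), (nsnd x). now rewrite npair_eta.
Qed.

Lemma rec_hardwire X c : rec_in X (fun i => code_num (hardwire c i)).
Proof.
assert (H : rec_in X (fun i => code_num (const_code i))).
{ eapply rec_ext; [|apply (@rec_iter X (fun i => i)
    (fun n => npair 6 (npair (code_num CSucc) n)) (fun _ => code_num CZero));
    [apply rec_id| |apply rec_const]].
  - intros i. simpl. induction i as [|i IH]; trivial. simpl. now rewrite IH.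
  - apply (@rec_npair X (fun _ => 6)
      (fun n => npair (code_num CSucc) n)); [apply rec_const|].
    apply rec_npair; [apply rec_const|apply rec_id]. }
simpl. repeat (apply rec_npair || apply rec_const || exact H).
Qed.

Lemma char_index_hardwire X c f Y i :
  computes X c f ->
  (forall x, (Y x -> f (npair i x) = 1) /\ (~ Y x -> f (npair i x) = 0)) ->
  char_index X (code_num (hardwire c i)) Y.
Proof.
intros Hc H x. unfold computes in Hc. rewrite !phi_code_num, !eval_hardwire, !Hc.
destruct (H x) as [H1 H2]. split; intros Hx; symmetry; auto.
Qed.

Lemma turing_le_dec X p Y :
  dec_in X p -> (forall x, Y x <-> p x = true) -> turing_le Y X.
Proof.
intros [c Hc] H. exists (code_num c). intros x. unfold computes in Hc.
rewrite !phi_code_num, !Hc. specialize (H x).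
destruct (p x); simpl; intuition discriminate.
Qed.

Lemma ce_in_dec X p Y :
  dec_in X p -> (forall x, Y x <-> p x = true) -> ce_in X Y.
Proof.
intros Hp H. destruct (semidecidable Hp) as [c Hc].
exists (code_num c). intros x. rewrite H, <- Hc.
unfold W. setoid_rewrite phi_code_num. reflexivity.
Qed.

(** * The structure *)

Definition halt (e n : nat) : bool := haltsb (fun _ => 0) e e n.

Lemma char_fun_empty : char_fun empty_oracle (fun _ => 0).
Proof. intros x. right. split; [intros []|reflexivity]. Qed.

Lemma zero_jump_halt e : zero_jump e <-> exists n, halt e n = true.
Proof. apply haltsb_W, char_fun_empty. Qed.

Lemma dec_halt X f g :
  rec_in X f -> rec_in X g -> dec_in X (fun z => halt (f z) (g z)).
Proof. intros Hf Hg. apply dec_haltsb; trivial. apply rec_const. Qed.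

(** The first halting time is [S w]. No run halts in 0 steps, so each halting program has exactly
    one such [w]. *)
Definition first_halt (e w : nat) : bool := halt e (S w) && negb (halt e w).

Lemma first_halt_unique e w w' :
  first_halt e w = true -> first_halt e w' = true -> w = w'.
Proof.
assert (H : forall v v', v < v' -> first_halt e v = true ->
                         first_halt e v' = true -> False).
{ intros v v' L H1 H2. apply andb_true_iff in H1 as [H1 _].
  apply andb_true_iff in H2 as [_ H2].
  unfold halt in *. now rewrite (@haltsb_mono _ _ _ _ _ L H1) in H2. }
intros H1 H2. destruct (Nat.lt_total w w') as [L|[L|L]]; trivial;
  exfalso; eauto.
Qed.

Lemma first_halt_exists e n : halt e n = true ->
  exists w, w < n /\ first_halt e w = true.
Proof.
induction n as [|n IH]; intros H; [unfold halt in H; now rewrite haltsb_0 in H|].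
destruct (halt e n) eqn:Hn.
- destruct (IH eq_refl) as [w [L Hw]]. exists w. auto.
- exists n. unfold first_halt. rewrite H, Hn. auto.
Qed.

(** * Vertices and edges *)

Definition spine (k : nat) : nat := npair k 0.
Definition side (k : nat) (b : bool) : nat := npair k (if b then 1 else 2).
Definition mark (k w : nat) : nat := npair k (3 + w).

(** Since [w <= mark k w], the mark of [k] bounds the time at which program [k]
    halts on input [k]. *)
Definition point (x : nat) : bool :=
  (nsnd x =? 0) || (nsnd x =? 1) || (nsnd x =? 2)
  || first_halt (nfst x) (pred (pred (pred (nsnd x)))).

(** Defined on all numbers and decidable without knowing which programs halt: the out-neighbours of
    a number are read off the number itself. The cases are listed in [edge_spec]. *)
Definition edge (x y : nat) : bool :=
  if nsnd x =? 0 then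
    negb (nfst x =? 0) && ((y =? npair (nfst x) 0) || (y =? npair (pred (nfst x)) 0))
  else if (nsnd x =? 1) || (nsnd x =? 2) then y =? npair (nfst x) 0
  else y =? npair (nfst x) 1.

Lemma dec_point X : dec_in X point.
Proof.
unfold point, first_halt. apply dec_orb; [solve_rec|].
apply dec_andb; [|apply dec_negb]; apply dec_halt; solve_rec.
Qed.

Lemma dec_edge X f g :
  rec_in X f -> rec_in X g -> dec_in X (fun z => edge (f z) (g z)).
Proof. intros Hf Hg. unfold edge. solve_rec. Qed.

Lemma point_spine k : point (spine k) = true.
Proof. unfold point, spine. now pair_simpl. Qed.

Lemma point_side k b : point (side k b) = true.
Proof. unfold point, side. pair_simpl. now destruct b. Qed.

Lemma point_mark k w : point (mark k w) = first_halt k w.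
Proof. unfold point, mark. now pair_simpl. Qed.

Lemma nat_cases x :
  (exists k, x = spine k) \/ (exists k b, x = side k b) \/
  (exists k w, x = mark k w).
Proof.
rewrite <- (npair_eta x). destruct (nsnd x) as [|[|[|w]]].
- left. now exists (nfst x).
- right; left. now exists (nfst x), true.
- right; left. now exists (nfst x), false.
- right; right. now exists (nfst x), w.
Qed.

Lemma spine_inj k k' : spine k = spine k' -> k = k'.
Proof. intros H. now apply npair_inj in H. Qed.

Lemma side_inj k b k' b' : side k b = side k' b' -> k = k' /\ b = b'.
Proof.
intros H. apply npair_inj in H as [-> H]. split; trivial.
now destruct b, b'.
Qed.

Lemma mark_inj k w k' w' : mark k w = mark k' w' -> k = k' /\ w = w'.
Proof. intros H. apply npair_inj in H as [-> H]. split; lia. Qed.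

Lemma spine_side k k' b : spine k <> side k' b.
Proof. intros H. apply npair_inj in H as [_ H]. now destruct b. Qed.

Lemma spine_mark k k' w : spine k <> mark k' w.
Proof. intros H. now apply npair_inj in H as [_ H]. Qed.

Lemma side_mark k b k' w : side k b <> mark k' w.
Proof. intros H. apply npair_inj in H as [_ H]. now destruct b. Qed.

Ltac point_inv :=
  repeat match goal with
  | H : spine _ = spine _ |- _ => apply spine_inj in H
  | H : side _ _ = side _ _ |- _ => apply side_inj in H as [? ?]
  | H : mark _ _ = mark _ _ |- _ => apply mark_inj in H as [? ?]
  | H : spine _ = side _ _ |- _ => now apply spine_side in H
  | H : side _ _ = spine _ |- _ => symmetry in H; now apply spine_side in H
  | H : spine _ = mark _ _ |- _ => now apply spine_mark in H
  | H : mark _ _ = spine _ |- _ => symmetry in H; now apply spine_mark in H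
  | H : side _ _ = mark _ _ |- _ => now apply side_mark in H
  | H : mark _ _ = side _ _ |- _ => symmetry in H; now apply side_mark in H
  end.

Inductive edge_spec : nat -> nat -> Prop :=
| edge_loop k : edge_spec (spine (S k)) (spine (S k))
| edge_down k : edge_spec (spine (S k)) (spine k)
| edge_side k b : edge_spec (side k b) (spine k)
| edge_mark k w : edge_spec (mark k w) (side k true).

Lemma edgeP x y : edge x y = true <-> edge_spec x y.
Proof.
split.
- intros H. unfold edge in H.
  destruct (nat_cases x) as [[k ->]|[[k [b ->]]|[k [w ->]]]].
  + unfold spine in H. rewrite nfst_npair, nsnd_npair in H. simpl in H.
    destruct k as [|k]; [discriminate|]. simpl in H.
    apply orb_true_iff in H as [H|H]; apply Nat.eqb_eq in H; subst;
      constructor.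
  + unfold side in H. rewrite nfst_npair, nsnd_npair in H.
    assert (E : y = spine k) by (destruct b; now apply Nat.eqb_eq in H).
    subst. constructor.
  + unfold mark in H. rewrite nfst_npair, nsnd_npair in H. simpl in H.
    apply Nat.eqb_eq in H. subst. apply edge_mark.
- unfold edge.
  intros []; unfold spine, side, mark; pair_simpl; simpl;
    rewrite ?Nat.eqb_refl, ?orb_true_r; trivial.
  now destruct b.
Qed.

(** * The language and the computability of the graph *)

Lemma zero_symbol_computable : computable (fun n => n = 0).
Proof.
apply (@turing_le_dec _ (fun n => n =? 0)).
- solve_rec.
- intros n. symmetry. apply Nat.eqb_eq.
Qed.

Lemma no_symbol_computable : computable (fun _ => False).
Proof.
apply (@turing_le_dec _ (fun n => false)); [solve_rec|easy].
Qed.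

Lemma arity_two_computable : exists e, forall n,
  n = 0 \/ False -> phi empty_oracle e n 2.
Proof.
destruct (rec_const empty_oracle 2) as [c Hc]. exists (code_num c).
intros n _. apply phi_code_num. now apply Hc.
Qed.

Definition graph_language : language :=
  @Language (fun n => n = 0) (fun _ => False) (fun _ => 2)
    (fun _ _ H => H) (fun _ _ => Nat.lt_0_2)
    zero_symbol_computable no_symbol_computable arity_two_computable.

Definition edge_rel (n : nat) (a : list nat) : Prop :=
  match a with [x; y] => edge x y = true | _ => False end.

Definition graph : structure graph_language nat :=
  @Structure graph_language nat (fun x => point x = true) edge_rel
    (fun _ _ => 0) (fun _ _ H _ _ => False_ind _ H).

(** Membership and edges are decided by programs that take [i] as a parameter; hardwiring [i] turns
    them into indices depending computably on [i]. *)
Lemma structure_index_uniform (A : nat -> structure graph_language nat) D :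
  dec_in empty_oracle D ->
  (forall i x, dom (A i) x <-> D (npair i x) = true) ->
  (forall i, rel (A i) = edge_rel) ->
  exists ix, rec_in empty_oracle ix /\ forall i, structure_index (ix i) (A i).
Proof.
intros HD HA Hrel.
(* [u] and [v] extract the two entries of a coded argument list. Encoding them again and comparing,
   in [args], rejects lists of any other length. *)
set (u := fun z => nfst (pred (nsnd (nsnd z)))).
set (v := fun z => nfst (pred (nsnd (pred (nsnd (nsnd z)))))).
set (args := fun z =>
  (nsnd z =? npair 0 (S (npair (u z) (S (npair (v z) 0)))))
  && (D (npair (nfst z) (u z)) && D (npair (nfst z) (v z)))).
assert (Hu : rec_in empty_oracle u) by (unfold u; solve_rec).
assert (Hv : rec_in empty_oracle v) by (unfold v; solve_rec).
assert (Hargs : dec_in empty_oracle args) by (unfold args; solve_rec).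
assert (Hargs_spec : forall i x, args (npair i x) = true <->
  exists a b, x = npair 0 (list_code [a; b]) /\
    u (npair i x) = a /\ v (npair i x) = b /\ rel_args (A i) 0 [a; b]).
{ intros i x. unfold args. rewrite nfst_npair, nsnd_npair.
  rewrite !andb_true_iff, Nat.eqb_eq, <- !HA. split.
  - intros [E [H1 H2]]. exists (u (npair i x)), (v (npair i x)).
    repeat split; trivial. auto.
  - intros [a [b [E [-> [-> [_ [_ H]]]]]]]. inversion H as [|? ? Ha H']; subst.
    inversion H'; subst. auto. }
assert (Huv : forall i a b,
  u (npair i (npair 0 (list_code [a; b]))) = a /\
  v (npair i (npair 0 (list_code [a; b]))) = b).
{ intros i a b. unfold u, v. simpl. pair_simpl. simpl. pair_simpl. simpl.
  now pair_simpl. }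
assert (Hbin : forall i n a, rel_args (A i) n a ->
  n = 0 /\ exists x y, a = [x; y]).
{ intros i n a [Hn [Hl _]]. split; [exact Hn|].
  destruct a as [|x [|y [|z a]]]; try discriminate. now exists x, y. }
assert (Hp : dec_in empty_oracle (fun z => args z && edge (u z) (v z)))
  by (apply dec_andb; [exact Hargs|now apply dec_edge]).
assert (Hq : dec_in empty_oracle (fun z => args z && negb (edge (u z) (v z))))
  by (apply dec_andb; [exact Hargs|now apply dec_negb, dec_edge]).
assert (semi : forall p (Y : nat -> nat -> Prop), dec_in empty_oracle p ->
  (forall i x, Y i x <-> p (npair i x) = true) ->
  exists c, forall i, ce_index empty_oracle (code_num (hardwire c i)) (Y i)).
{ intros p Y Hdec HY. destruct (semidecidable Hdec) as [c Hc].
  exists c. intros i x. rewrite HY, <- Hc. unfold W.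
  setoid_rewrite phi_code_num. setoid_rewrite eval_hardwire. reflexivity. }
destruct (semi _ (fun i => rel_set (A i)) Hp) as [cp Hcp].
{ intros i x. rewrite andb_true_iff, Hargs_spec. split.
  - intros [n [a [-> [H1 H2]]]].
    destruct (Hbin _ _ _ H1) as [-> [y [z ->]]].
    destruct (Huv i y z) as [-> ->].
    rewrite Hrel in H2. split; [|exact H2]. now exists y, z.
  - intros [[a [b [E [Ea [Eb H]]]]] H1]. rewrite Ea, Eb in H1.
    exists 0, [a; b]. split; [exact E|]. split; [exact H|].
    now rewrite Hrel. }
destruct (semi _ (fun i => neg_rel_set (A i)) Hq) as [cq Hcq].
{ intros i x. rewrite andb_true_iff, Hargs_spec. split.
  - intros [n [a [-> [H1 H2]]]].
    destruct (Hbin _ _ _ H1) as [-> [y [z ->]]].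
    destruct (Huv i y z) as [-> ->].
    rewrite Hrel in H2. split; [now exists y, z|].
    apply negb_true_iff, not_true_iff_false, H2.
  - intros [[a [b [E [Ea [Eb H]]]]] H1]. rewrite Ea, Eb in H1.
    exists 0, [a; b]. split; [exact E|]. split; [exact H|].
    rewrite Hrel. now apply not_true_iff_false, negb_true_iff. }
destruct (semi _ (fun i => fn_set (A i)) (dec_const _ false)) as [cg Hcg].
{ intros i x. split; [|discriminate]. intros [m [a [_ [[] _]]]]. }
destruct HD as [cd Hcd].
exists (fun i => npair (code_num (hardwire cd i))
  (npair (code_num (hardwire cp i)) (npair (code_num (hardwire cq i))
    (code_num (hardwire cg i))))).
split; [repeat (apply rec_hardwire || apply rec_npair)|].
intros i. do 4 eexists. split; [reflexivity|].
split; [|split; [apply Hcp|split; [apply Hcq|apply Hcg]]].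
apply (@char_index_hardwire _ _ _ _ _ Hcd). intros x. rewrite HA.
destruct (D (npair i x)); simpl; intuition discriminate.
Qed.

(** * The canonical computable age of the graph *)

Lemma cl_graph a x : cl graph a x <-> In x a.
Proof.
split.
- intros H. apply H; [now apply Forall_forall|]. intros m xs [].
- intros Hx P Ha _. rewrite Forall_forall in Ha. auto.
Qed.

Lemma graph_computable : computable_structure graph.
Proof.
assert (HD : dec_in empty_oracle (fun z => point (nsnd z)))
  by (apply (dec_comp (dec_point _)); solve_rec).
destruct (@structure_index_uniform (fun _ => graph) _ HD) as [ix [_ H]].
- intros i x. rewrite nsnd_npair. reflexivity.
- reflexivity.
- exists (ix 0). apply H.
Qed.

(** The second component of [i] varies freely, which makes every tuple recur infinitely often. Codes
    with an entry outside the graph stand for the empty tuple. *)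
Definition tuple (i : nat) : list nat :=
  if forallb point (list_dec (nfst i)) then list_dec (nfst i) else [].

Lemma rec_tuple X f : rec_in X f -> rec_in X (fun i => list_code (tuple (f i))).
Proof.
apply (@rec_comp X (fun i => list_code (tuple i))).
apply (rec_ext (f := fun i =>
  if forallb point (list_dec (nfst i)) then nfst i else 0)).
- intros i. unfold tuple. destruct forallb; trivial.
  now rewrite list_code_dec.
- apply rec_if; [|solve_rec|solve_rec].
  apply dec_forallb; [apply dec_point|solve_rec].
Qed.

Lemma tuple_points i : Forall (dom graph) (tuple i).
Proof.
unfold tuple. destruct forallb eqn:H; [|constructor].
apply Forall_forall. now apply forallb_forall.
Qed.

Lemma tuple_code a n : Forall (dom graph) a ->
  tuple (npair (list_code a) n) = a.
Proof.
intros H. unfold tuple. rewrite nfst_npair, list_dec_code.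
replace (forallb point a) with true; trivial. symmetry.
apply forallb_forall. now apply Forall_forall.
Qed.

Lemma graph_age : exists K : computable_age graph_language,
  canonical_age graph K /\ gens K = tuple /\
  str K = fun i => cl_structure graph (tuple i).
Proof.
assert (HD : dec_in empty_oracle
  (fun z => memb (nsnd z) (list_dec (list_code (tuple (nfst z)))))).
{ apply dec_memb; [solve_rec|]. apply rec_tuple. solve_rec. }
destruct (@structure_index_uniform
  (fun i => cl_structure graph (tuple i)) _ HD) as [ix [Hix H]].
- intros i x. simpl. rewrite nfst_npair, nsnd_npair, list_dec_code, memb_In.
  apply cl_graph.
- reflexivity.
- assert (G : forall i, Forall (dom (cl_structure graph (tuple i))) (tuple i)).
  { intros i. apply Forall_forall. intros x Hx. now apply cl_graph. }
  assert (C : forall i x, dom (cl_structure graph (tuple i)) x <->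
                          cl (cl_structure graph (tuple i)) (tuple i) x).
  { intros i x. simpl. reflexivity. }
  (* The set is even decidable: [i] is the last component of the code, and the triple is computed
     again from it. *)
  assert (T : ce (fun n => exists i, n = triple_code (tuple i) (ix i) i)).
  { apply (@ce_in_dec _ (fun n => n =?
      npair (list_code (tuple (nsnd (nsnd n))))
        (npair (ix (nsnd (nsnd n))) (nsnd (nsnd n))))).
    - apply dec_eqb; [solve_rec|].
      apply rec_npair; [apply rec_tuple|]; solve_rec.
    - intros n. rewrite Nat.eqb_eq. split.
      + intros [i ->]. unfold triple_code. now pair_simpl.
      + intros ->. exists (nsnd (nsnd n)). reflexivity. }
  exists (@ComputableAge graph_language tuple
    (fun i => cl_structure graph (tuple i)) ix H G C T). split; [|split; reflexivity].
  split; [|split; [|split]].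
  + destruct (rec_tuple (rec_id empty_oracle)) as [c Hc].
    exists (code_num c). intros i. apply phi_code_num. now apply Hc.
  + apply tuple_points.
  + intros a Ha N. exists (npair (list_code a) N).
    split; [apply npair_ge_r|now apply tuple_code].
  + intros i. split; [|split]; reflexivity.
Qed.

(** * Embeddings into the graph *)

Lemma nfst_spine k : nfst (spine k) = k.
Proof. apply nfst_npair. Qed.

Lemma nfst_side k b : nfst (side k b) = k.
Proof. apply nfst_npair. Qed.

Lemma nfst_mark k w : nfst (mark k w) = k.
Proof. apply nfst_npair. Qed.

Definition graph_emb (P : nat -> Prop) (g : nat -> nat) : Prop :=
  (forall x, P x -> point x = true /\ point (g x) = true) /\
  (forall x y, P x -> P y -> g x = g y -> x = y) /\
  (forall x y, P x -> P y -> (edge x y = true <-> edge (g x) (g y) = true)).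

Lemma edge_spec_inv x y : edge_spec x y ->
  (exists k, x = spine (S k) /\ (y = spine (S k) \/ y = spine k)) \/
  (exists k b, x = side k b /\ y = spine k) \/
  (exists k w, x = mark k w /\ y = side k true).
Proof. intros []; eauto 8. Qed.

Lemma edge_spec_loop x : edge_spec x x -> exists k, x = spine (S k).
Proof.
intros H. apply edge_spec_inv in H
  as [[k [-> _]]|[[k [b [-> H]]]|[k [w [-> H]]]]]; point_inv. eauto.
Qed.

Lemma edge_spec_spine k y :
  edge_spec (spine k) y -> y = spine k \/ k <> 0 /\ y = spine (pred k).
Proof.
intros H. apply edge_spec_inv in H
  as [[j [E H]]|[[j [b [E H]]]|[j [w [E H]]]]]; point_inv.
subst. destruct H; auto.
Qed.

Lemma graph_emb_edge P g x y : graph_emb P g -> P x -> P y ->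
  edge_spec x y -> edge_spec (g x) (g y).
Proof. intros [_ [_ H]] Hx Hy. rewrite <- !edgeP. now apply H. Qed.

Lemma graph_emb_edge_inv P g x y : graph_emb P g -> P x -> P y ->
  edge_spec (g x) (g y) -> edge_spec x y.
Proof. intros [_ [_ H]] Hx Hy. rewrite <- !edgeP. now apply H. Qed.

(** [spine 0] is the only vertex of the spine without a loop. *)
Lemma graph_emb_spine P g n : graph_emb P g ->
  (forall k, k <= S n -> P (spine k)) ->
  forall k, k <= S n -> g (spine k) = spine k.
Proof.
intros Hg HP. pose proof Hg as [_ [Hinj _]].
(* A loop goes to a loop, so [spine (S k)] goes to some [spine (S m)]; by injectivity its other
   out-neighbour goes to the other out-neighbour [spine m]. *)
assert (L : forall k, k <= n -> exists m, g (spine (S k)) = spine (S m) /\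
  g (spine k) = spine m).
{ intros k Hk. pose proof (HP (S k)) as P1. pose proof (HP k) as P0.
  destruct (@edge_spec_loop (g (spine (S k)))) as [m Hm].
  { apply (graph_emb_edge Hg); [apply P1; lia|apply P1; lia|constructor]. }
  exists m. split; [exact Hm|].
  assert (E : edge_spec (spine (S m)) (g (spine k))).
  { rewrite <- Hm.
    apply (graph_emb_edge Hg); [apply P1; lia|apply P0; lia|constructor]. }
  apply edge_spec_spine in E as [E|[_ E]]; [|exact E].
  rewrite <- Hm in E. apply Hinj in E; [|apply P0; lia|apply P1; lia].
  apply spine_inj in E. lia. }
induction k as [|k IH]; intros Hk.
(* An image [spine (S m)] of [spine 0] would have a loop, which the embedding reflects. *)
- destruct (L 0) as [[|m] [_ H0]]; [lia|exact H0|exfalso].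
  assert (E : edge_spec (spine 0) (spine 0)).
  { apply (graph_emb_edge_inv _ _ Hg); [apply HP; lia|apply HP; lia|].
    rewrite H0. constructor. }
  apply edge_spec_loop in E as [j E]. apply spine_inj in E. discriminate.
- destruct (L k) as [m [H1 H2]]; [lia|]. rewrite IH in H2 by lia.
  apply spine_inj in H2. now subst.
Qed.

(** A vertex pointing to the fixed vertex [spine k] is a side of [k] or a spine vertex with a loop;
    a side has no loop, and loops are reflected. *)
Lemma graph_emb_side P g n : graph_emb P g ->
  (forall k, k <= S n -> P (spine k)) ->
  forall k b, k <= S n -> P (side k b) -> exists b', g (side k b) = side k b'.
Proof.
intros Hg HP k b Hk Hs. pose proof (graph_emb_spine Hg HP Hk) as Hspine.
assert (E : edge_spec (g (side k b)) (spine k)).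
{ rewrite <- Hspine. apply (graph_emb_edge Hg); auto. constructor. }
apply edge_spec_inv in E as [[j [E _]]|[[j [b' [E H]]]|[j [w [E H]]]]];
  point_inv.
- assert (F : edge_spec (side k b) (side k b)).
  { apply (graph_emb_edge_inv _ _ Hg); trivial. rewrite E. constructor. }
  apply edge_spec_loop in F as [i F]. point_inv.
- subst. eauto.
Qed.

(** The image of the mark points to a side of [k]. Only [side k true] has in-neighbours, namely
    marks of [k], and [k] has just one mark that is a vertex. *)
Lemma graph_emb_mark P g n : graph_emb P g ->
  (forall k, k <= S n -> P (spine k)) ->
  forall k w, k <= S n -> P (side k true) -> P (mark k w) ->
  g (side k true) = side k true /\ g (mark k w) = mark k w.
Proof.
intros Hg HP k w Hk Hs Hm.
destruct (graph_emb_side Hg HP true Hk Hs) as [b Hb].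
assert (E : edge_spec (g (mark k w)) (side k b)).
{ rewrite <- Hb. apply (graph_emb_edge Hg); trivial. constructor. }
destruct Hg as [Hpoint _].
apply edge_spec_inv in E as [[j [_ [H|H]]]|[[j [c [_ H]]]|[j [v [E H]]]]];
  point_inv. subst. split; [exact Hb|].
rewrite E. f_equal. destruct (Hpoint _ Hm) as [H1 H2].
rewrite E in H2. rewrite point_mark in H1, H2.
now apply (first_halt_unique j).
Qed.

(** [s] selects the levels whose sides are exchanged. This is an automorphism of the graph if no
    selected level has a mark. *)
Definition swap (s : nat -> bool) (x : nat) : nat :=
  if s (nfst x) then
    if nsnd x =? 1 then npair (nfst x) 2
    else if nsnd x =? 2 then npair (nfst x) 1 else x
  else x.

Lemma swap_spine s k : swap s (spine k) = spine k.
Proof. unfold swap, spine. pair_simpl. now destruct (s k). Qed.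

Lemma swap_side s k b : swap s (side k b) = side k (xorb (s k) b).
Proof. unfold swap, side. pair_simpl. now destruct (s k), b. Qed.

Lemma swap_mark s k w : swap s (mark k w) = mark k w.
Proof. unfold swap, mark. pair_simpl. now destruct (s k). Qed.

Lemma swap_involutive s x : swap s (swap s x) = x.
Proof.
destruct (nat_cases x) as [[k ->]|[[k [b ->]]|[k [w ->]]]];
  rewrite ?swap_spine, ?swap_side, ?swap_mark; trivial.
now destruct (s k), b.
Qed.

Lemma point_swap s x : point x = true -> point (swap s x) = true.
Proof.
destruct (nat_cases x) as [[k ->]|[[k [b ->]]|[k [w ->]]]];
  rewrite ?swap_spine, ?swap_side, ?swap_mark; trivial.
intros _. apply point_side.
Qed.

(** Only an edge starting at a mark can be broken, hence the condition on the source [x] alone. The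
    converse follows by swapping back. *)
Lemma edge_swap s x y : (forall k w, x = mark k w -> s k = false) ->
  (edge x y = true <-> edge (swap s x) (swap s y) = true).
Proof.
assert (H : forall u v, (forall k w, u = mark k w -> s k = false) ->
  edge u v = true -> edge (swap s u) (swap s v) = true).
{ intros u v Hu E. apply edgeP. apply edgeP in E. destruct E;
    rewrite ?swap_spine, ?swap_side, ?swap_mark; try constructor.
  rewrite (Hu _ _ eq_refl). constructor. }
intros Hx. split; [now apply H|]. intros E. apply H in E.
- now rewrite !swap_involutive in E.
- intros k w Hk. apply (Hx k w).
  rewrite <- (swap_involutive s x), Hk. apply swap_mark.
Qed.

Lemma is_embedding_graph T U (A : structure graph_language T)
    (B : structure graph_language U) f :
  is_embedding A B f <->
  (forall x, dom A x -> dom B (f x)) /\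
  (forall x y, dom A x -> dom A y -> f x = f y -> x = y) /\
  (forall x y, dom A x -> dom A y -> (rel A 0 [x; y] <-> rel B 0 [f x; f y])).
Proof.
split.
- intros [H1 [H2 [H3 _]]]. repeat split; trivial;
    apply (H3 0 [x; y]); repeat split; auto.
- intros [H1 [H2 H3]]. split; [exact H1|]. split; [exact H2|]. split.
  + intros n a [Hn [Hl Ha]]. simpl in Hn. subst.
    destruct a as [|x [|y [|z a]]]; try discriminate.
    inversion Ha as [|? ? Hx Ha']; subst. inversion Ha'; subst. now apply H3.
  + intros m a [[] _].
Qed.

Lemma is_embedding_comp T U V (A : structure graph_language T)
    (B : structure graph_language U) (C : structure graph_language V) f g :
  is_embedding A B f -> is_embedding B C g ->
  is_embedding A C (fun x => g (f x)).
Proof.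
rewrite !is_embedding_graph. intros [F1 [F2 F3]] [G1 [G2 G3]].
repeat split; auto.
- intros HR. apply G3, F3; auto.
- intros HR. apply F3, G3; auto.
Qed.

(** Preimages are chosen by [epsilon]. This brings members of the age, which live on arbitrary
    types, back into the graph. *)
Lemma isomorphic_inverse U (A : structure graph_language nat)
    (B : structure graph_language U) :
  isomorphic A B -> exists g, is_embedding B A g.
Proof.
intros [f [Hf Hsurj]].
set (g := fun y => epsilon (inhabits 0) (fun x => dom A x /\ f x = y)).
assert (Hg : forall y, dom B y -> dom A (g y) /\ f (g y) = y).
{ intros y Hy. unfold g. apply epsilon_spec. auto. }
exists g. apply is_embedding_graph in Hf as [_ [_ F3]].
apply is_embedding_graph. split; [|split].
- intros y Hy. now apply Hg.
- intros y z Hy Hz E. rewrite <- (proj2 (Hg y Hy)), E. now apply Hg.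
- intros y z Hy Hz. destruct (Hg y Hy) as [Dy Ey], (Hg z Hz) as [Dz Ez].
  rewrite (F3 _ _ Dy Dz), Ey, Ez. reflexivity.
Qed.

Definition sub (a : list nat) : structure graph_language nat :=
  cl_structure graph a.

Lemma graph_emb_sub a b g :
  Forall (dom graph) a -> Forall (dom graph) b ->
  is_embedding (sub a) (sub b) g -> graph_emb (fun x => In x a) g.
Proof.
rewrite !Forall_forall. intros Ha Hb H.
apply is_embedding_graph in H as [H1 [H2 H3]].
split; [|split].
- intros x Hx. split; [now apply Ha|]. apply Hb, cl_graph, H1.
  now apply cl_graph.
- intros x y Hx Hy. apply H2; now apply cl_graph.
- intros x y Hx Hy. apply (H3 x y); now apply cl_graph.
Qed.

Lemma swap_embedding s a b :
  (forall k w, In (mark k w) a -> s k = false) ->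
  incl (map (swap s) a) b -> is_embedding (sub a) (sub b) (swap s).
Proof.
intros Hs Hab. apply is_embedding_graph. split; [|split].
- intros x Hx. apply cl_graph in Hx. apply cl_graph, Hab. now apply in_map.
- intros x y _ _ E. rewrite <- (swap_involutive s x), E.
  apply swap_involutive.
- intros x y Hx _. apply edge_swap. intros k w ->. apply cl_graph in Hx.
  now apply (Hs k w).
Qed.

Lemma incl_embedding a b :
  incl a b -> is_embedding (sub a) (sub b) (fun x => x).
Proof.
intros Hab. apply is_embedding_graph. split; [|split]; trivial.
- intros x Hx. apply cl_graph in Hx. apply cl_graph. auto.
- reflexivity.
Qed.

(** Each vertex of [a] is sent to the entry of [b] at a chosen position of that vertex. Equality
    formulas give injectivity, relational ones the edges. *)
Lemma atomic_equiv_embedding a b c :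
  atomic_equiv (sub a) a (sub c) b -> incl b c ->
  exists g, is_embedding (sub a) (sub c) g.
Proof.
intros [Hl H] Hbc.
(* The 0 in [nth] is what the default of [term_val] reduces to in the graph. *)
assert (Heq : forall i j, i < length a -> j < length a ->
  (nth i a 0 = nth j a 0 <-> nth i b 0 = nth j b 0)).
{ intros i j Hi Hj. apply (H (Eq (Var i) (Var j))). split; now constructor. }
assert (Hrel : forall i j, i < length a -> j < length a ->
  (edge (nth i a 0) (nth j a 0) = true <->
   edge (nth i b 0) (nth j b 0) = true)).
{ intros i j Hi Hj. apply (H (Rel 0 [Var i; Var j])).
  split; [reflexivity|]. split; [reflexivity|].
  intros t [<-|[<-|[]]]; now constructor. }
set (pos := fun x => epsilon (inhabits 0)
                       (fun i => i < length a /\ nth i a 0 = x)).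
assert (Hpos : forall x, cl graph a x ->
  pos x < length a /\ nth (pos x) a 0 = x).
{ intros x Hx. unfold pos. apply epsilon_spec.
  apply cl_graph, (In_nth _ _ 0) in Hx as [i Hi]. now exists i. }
exists (fun x => nth (pos x) b 0). apply is_embedding_graph.
split; [|split].
- intros x Hx. apply cl_graph, Hbc, nth_In. rewrite <- Hl. now apply Hpos.
- intros x y Hx Hy E. destruct (Hpos x Hx) as [Lx Ex], (Hpos y Hy) as [Ly Ey].
  apply Heq in E; trivial. congruence.
- intros x y Hx Hy. destruct (Hpos x Hx) as [Lx Ex], (Hpos y Hy) as [Ly Ey].
  rewrite <- Ex at 1. rewrite <- Ey at 1. now apply Hrel.
Qed.

(** * Amalgamation bases *)

Definition represents_graph (C : age graph_language) : Prop :=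
  forall T (B : structure graph_language T),
    in_age C B <->
    exists a, Forall (dom graph) a /\ isomorphic (sub a) B.

Lemma in_age_sub C a :
  represents_graph C -> Forall (dom graph) a -> in_age C (sub a).
Proof.
intros HC Ha. apply HC. exists a. split; [exact Ha|].
apply same_structure_iso. repeat split; auto.
Qed.

Lemma in_age_embedding C T (B : structure graph_language T) :
  represents_graph C -> in_age C B ->
  exists a g, Forall (dom graph) a /\ is_embedding B (sub a) g.
Proof.
intros HC HB. apply HC in HB as [a [Ha Hi]].
apply isomorphic_inverse in Hi as [g Hg]. now exists a, g.
Qed.

(** A level has at most one mark and is therefore finite. Whether it has one is decided classically;
    this is the noneffective step behind (CAP). *)
Lemma ball_exists n : exists b, forall x,
  In x b <-> point x = true /\ nfst x <= n.
Proof.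
assert (level : forall k, exists b, forall x,
  In x b <-> point x = true /\ nfst x = k).
{ intros k. set (l := [spine k; side k true; side k false]).
  assert (Hl : forall x, In x l -> point x = true /\ nfst x = k).
  { intros x [<-|[<-|[<-|[]]]];
      (split; [auto using point_spine, point_side|apply nfst_npair]). }
  assert (Hl' : forall x, nfst x = k -> In x l \/ exists w, x = mark k w).
  { intros x. destruct (nat_cases x) as [[j ->]|[[j [c ->]]|[j [w ->]]]];
      rewrite ?nfst_spine, ?nfst_side, ?nfst_mark;
      intros ->; [left|left|right]; simpl; [auto|destruct c; auto|eauto]. }
  destruct (classic (exists w, first_halt k w = true)) as [[w Hw]|Hn].
  - exists (mark k w :: l). intros x. split.
    + intros [<-|Hx]; [|auto]. split; [now rewrite point_mark|].
      apply nfst_npair.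
    + intros [Hp Hx]. destruct (Hl' x Hx) as [H|[v ->]]; [now right|left].
      rewrite point_mark in Hp. f_equal. now apply (first_halt_unique k).
  - exists l. intros x. split; [auto|]. intros [Hp Hx].
    destruct (Hl' x Hx) as [H|[v ->]]; trivial. destruct Hn. exists v.
    now rewrite point_mark in Hp. }
induction n as [|n [b Hb]].
- destruct (level 0) as [b Hb]. exists b. intros x. rewrite Hb.
  now rewrite Nat.le_0_r.
- destruct (level (S n)) as [c Hc]. exists (b ++ c). intros x.
  rewrite in_app_iff, Hb, Hc, Nat.le_succ_r. tauto.
Qed.

(** The spine is fixed, and each pair of sides is fixed or exchanged. The ball contains all marks up
    to its level, so a marked pair is fixed. *)
Lemma ball_embedding n b g :
  (forall x, In x b <-> point x = true /\ nfst x <= S n) ->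
  graph_emb (fun x => In x b) g ->
  exists s, (forall k w, s k = true -> first_halt k w = false) /\
            forall x, In x b -> g x = swap s x.
Proof.
intros Hb Hg.
assert (Hspine : forall k, k <= S n -> In (spine k) b).
{ intros k Hk. apply Hb. split; [apply point_spine|].
  now rewrite nfst_spine. }
assert (Hside : forall k c, k <= S n -> In (side k c) b).
{ intros k c Hk. apply Hb. split; [apply point_side|].
  now rewrite nfst_side. }
assert (Hmark : forall k w, k <= S n -> first_halt k w = true ->
  In (mark k w) b).
{ intros k w Hk Hw. apply Hb. rewrite point_mark. split; [exact Hw|].
  now rewrite nfst_mark. }
exists (fun k => (k <=? S n) && (g (side k true) =? side k false)). split.
- intros k w H. apply andb_true_iff in H as [Hk H].
  apply Nat.leb_le in Hk. apply Nat.eqb_eq in H.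
  apply not_true_iff_false. intros Hw.
  destruct (graph_emb_mark Hg Hspine w Hk) as [E _]; auto.
  rewrite E in H. apply side_inj in H as [_ H]. discriminate.
- intros x Hx. assert (Hn : nfst x <= S n) by now apply Hb.
  destruct (nat_cases x) as [[k ->]|[[k [c ->]]|[k [w ->]]]];
    rewrite ?nfst_spine, ?nfst_side, ?nfst_mark in Hn;
    rewrite ?swap_spine, ?swap_side, ?swap_mark.
  + now apply (graph_emb_spine Hg Hspine).
  + destruct (graph_emb_side Hg Hspine true Hn (Hside k true Hn)) as [t Ht].
    destruct (graph_emb_side Hg Hspine false Hn (Hside k false Hn)) as [f Hf].
    apply Nat.leb_le in Hn as Hn'. rewrite Hn', Ht. simpl.
    assert (N : t <> f).
    { intros ->. rewrite <- Ht in Hf. destruct Hg as [_ [Hinj _]].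
      apply Hinj in Hf; auto. apply side_inj in Hf as [_ Hf]. discriminate. }
    assert (E : (side k t =? side k false) = negb t).
    { destruct t; [|apply Nat.eqb_refl]. apply Nat.eqb_neq. intros E.
      apply side_inj in E as [_ E]. discriminate. }
    rewrite E. destruct c, t, f; simpl; congruence.
  + apply (graph_emb_mark Hg Hspine); auto.
Qed.

(** By the previous lemma, an embedding of a ball is undone by an automorphism
    of the whole graph, which makes all embeddings compatible. *)
Lemma ball_amalgamation_base C n b : represents_graph C ->
  (forall x, In x b <-> point x = true /\ nfst x <= S n) ->
  amalgamation_base C (sub b).
Proof.
intros HC Hb.
assert (Db : Forall (dom graph) b) by (apply Forall_forall; intros x; apply Hb).
split; [now apply in_age_sub|].
assert (undo : forall T (B : structure graph_language T) f,
  in_age C B -> is_embedding (sub b) B f ->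
  exists d g, Forall (dom graph) d /\ is_embedding B (sub d) g /\
              forall x, In x b -> g (f x) = x).
{ intros T B f HB Hf.
  destruct (@in_age_embedding _ _ _ HC HB) as [a [g [Ha Hg]]].
  destruct (@ball_embedding n b (fun x => g (f x)) Hb) as [s [Hs Hgf]].
  { apply (graph_emb_sub Db Ha). now apply (is_embedding_comp Hf). }
  exists (map (swap s) a), (fun x => swap s (g x)). split; [|split].
  - apply Forall_map. eapply Forall_impl; [|exact Ha].
    intros x. apply point_swap.
  - apply (is_embedding_comp Hg). apply swap_embedding; [|apply incl_refl].
    (* [a] may contain marks outside the ball, but at a level selected by [s] no mark is a vertex of
       the graph. *)
    intros k w Hk. apply not_true_iff_false. intros E.
    rewrite Forall_forall in Ha. apply Ha in Hk. simpl in Hk.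
    rewrite point_mark, (Hs k w E) in Hk. discriminate.
  - intros x Hx. rewrite Hgf by exact Hx. apply swap_involutive. }
intros U V B1 B2 f1 f2 H1 H2 E1 E2.
destruct (undo U B1 f1 H1 E1) as [d1 [g1 [D1 [G1 F1]]]].
destruct (undo V B2 f2 H2 E2) as [d2 [g2 [D2 [G2 F2]]]].
(* Both copies of the ball now sit in the graph by inclusion, so the union of the two vertex sets
   amalgamates them. *)
exists nat, (sub (d1 ++ d2)), g1, g2.
split; [apply in_age_sub; trivial; now apply Forall_app|].
split; [exact (is_embedding_comp G1 (incl_embedding (incl_appl d2 (incl_refl d1))))|].
split; [exact (is_embedding_comp G2 (incl_embedding (incl_appr d1 (incl_refl d2))))|].
intros x Hx. apply cl_graph in Hx. now rewrite F1, F2.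
Qed.

Lemma graph_CAP C : represents_graph C -> CAP C.
Proof.
intros HC T A HA.
destruct (@in_age_embedding _ _ _ HC HA) as [a [g [Ha Hg]]].
(* The largest level in [a], plus one so that the ball contains [spine 1], a vertex with a loop. *)
destruct (ball_exists (S (list_max (map nfst a)))) as [b Hb].
exists nat, (sub b), g. split.
- now apply (@ball_amalgamation_base C (list_max (map nfst a)) b).
- apply (@is_embedding_comp _ _ _ _ _ _ g (fun x => x) Hg), incl_embedding.
  intros x Hx. apply Hb.
  rewrite Forall_forall in Ha. split; [now apply Ha|]. apply Nat.le_le_succ_r.
  pose proof (proj1 (list_max_le (map nfst a) _) (le_n _)) as M.
  rewrite Forall_forall in M. now apply M, in_map.
Qed.

(** * Reading the halting problem off amalgamation bases *)

Fixpoint spines (n : nat) : list nat :=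
  match n with 0 => [] | S k => spine k :: spines k end.

(** [spines n] ends below level [n]; the two successors give the spine up to level [S e], which
    contains a loop even for [e = 0]. *)
Definition probe (e : nat) : list nat := side e true :: spines (S (S e)).

Lemma in_spines n x : In x (spines n) <-> exists k, k < n /\ x = spine k.
Proof.
induction n as [|n IH]; simpl.
- split; [tauto|]. intros [k [H _]]. lia.
- rewrite IH. split.
  + intros [<-|[k [H ->]]]; [now exists n; auto|]. exists k. auto.
  + intros [k [H ->]]. destruct (Nat.eq_dec k n) as [->|N]; [now left|].
    right. exists k. split; [lia|reflexivity].
Qed.

Lemma probe_points e : Forall (dom graph) (probe e).
Proof.
constructor; [apply point_side|]. apply Forall_forall. intros x Hx.
apply in_spines in Hx as [k [_ ->]]. apply point_spine.
Qed.

Lemma rec_probe X f : rec_in X f -> rec_in X (fun e => list_code (probe (f e))).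
Proof.
intros Hf.
assert (H : rec_in X (fun n => list_code (spines n))).
{ eapply rec_ext; [|apply (@rec_nat_rect X (fun _ => 0)
    (fun z => S (npair (npair (nfst (nsnd z)) 0) (nsnd (nsnd z))))
    (fun n => n)); solve_rec].
  intros n. simpl. generalize n at 1 2. intros p.
  induction n as [|n IH]; simpl; trivial.
  rewrite IH. now pair_simpl. }
apply (rec_ext (f := fun e =>
  S (npair (npair (f e) 1) (list_code (spines (S (S (f e)))))))); [easy|].
apply rec_S, rec_npair; [solve_rec|].
apply (@rec_comp X (fun n => list_code (spines n))); solve_rec.
Qed.

(** Without the mark, the base also embeds with its two sides exchanged, and
    adding the mark to both copies makes amalgamation impossible. *)
Lemma base_contains_mark C e w b g : represents_graph C ->
  first_halt e w = true -> Forall (dom graph) b ->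
  is_embedding (sub (probe e)) (sub b) g ->
  amalgamation_base C (sub b) -> In (mark e w) b.
Proof.
intros HC Hw Hb Hg [_ Hbase].
assert (Gg := graph_emb_sub (probe_points e) Hb Hg).
assert (Pspine : forall k, k <= S e -> In (spine k) (probe e)).
{ intros k Hk. right. apply in_spines. exists k. split; [lia|trivial]. }
assert (g_in : forall x, In x (probe e) -> In (g x) b).
{ intros x Hx. apply cl_graph, Hg, cl_graph, Hx. }
assert (Bspine : forall k, k <= S e -> In (spine k) b).
{ intros k Hk. rewrite <- (graph_emb_spine Gg Pspine Hk). auto. }
assert (Pside : In (side e true) (probe e)) by now left.
assert (He : e <= S e) by lia.
destruct (graph_emb_side Gg Pspine true He Pside) as [c Hc].
assert (Bside : In (side e c) b) by (rewrite <- Hc; now apply g_in).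
apply NNPP. intros Hno.
set (b' := mark e w :: side e true :: side e false :: b).
assert (Hb' : Forall (dom graph) b').
{ repeat constructor; trivial.
  - simpl. now rewrite point_mark.
  - apply point_side.
  - apply point_side. }
(* The base goes into [b'] by inclusion and by exchanging the sides of [e]; its side [side e c] is
   on the mark's side in one copy and opposite in the other. *)
set (s := fun k => k =? e).
assert (Hs : is_embedding (sub b) (sub b') (swap s)).
{ apply swap_embedding.
  (* The absence of the mark from [b] enters here. *)
  - intros k v Hk. unfold s. apply Nat.eqb_neq. intros ->.
    rewrite Forall_forall in Hb. apply Hb in Hk as Hv. simpl in Hv.
    rewrite point_mark in Hv.
    now rewrite (first_halt_unique e v w Hv Hw) in Hk.
  - intros x Hx. apply in_map_iff in Hx as [y [<- Hy]].
    destruct (nat_cases y) as [[k ->]|[[k [d ->]]|[k [v ->]]]];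
      rewrite ?swap_spine, ?swap_side, ?swap_mark; [now do 3 right| |now do 3 right].
    unfold s. destruct (Nat.eqb_spec k e) as [->|N]; [|now do 3 right].
    destruct d; simpl; auto. }
assert (Hi : is_embedding (sub b) (sub b') (fun x => x)).
{ apply incl_embedding. now do 3 apply incl_tl. }
assert (Hage := in_age_sub HC Hb').
destruct (Hbase _ _ _ _ _ _ Hage Hage Hi Hs)
  as [Z [D [g1 [g2 [HD [E1 [E2 Hcomm]]]]]]].
destruct (@in_age_embedding _ _ _ HC HD) as [d [h [Hd Hh]]].
(* [b'] contains the mark, so the marked side is fixed, and the other one by injectivity. *)
assert (fix_sides : forall f, is_embedding (sub b') D f ->
  forall t, h (f (side e t)) = side e t).
{ intros f Hf.
  assert (G := graph_emb_sub Hb' Hd (is_embedding_comp Hf Hh)).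
  assert (Sp : forall k, k <= S e -> In (spine k) b').
  { intros k Hk. do 3 right. auto. }
  destruct (graph_emb_mark G Sp w He) as [Ht _]; [simpl; auto|simpl; auto|].
  intros [|]; [exact Ht|].
  destruct (graph_emb_side G Sp false He) as [[|] Hf']; [simpl; auto| |exact Hf'].
  rewrite <- Ht in Hf'. destruct G as [_ [Hinj _]].
  apply Hinj in Hf'; [|simpl; auto|simpl; auto].
  apply side_inj in Hf' as [_ Hf']. discriminate. }
assert (E : h (g1 (side e c)) = h (g2 (swap s (side e c)))).
{ f_equal. apply Hcomm. now apply cl_graph. }
rewrite swap_side, !fix_sides in E by trivial. unfold s in E.
rewrite Nat.eqb_refl in E. apply side_inj in E as [_ E]. now destruct c.
Qed.

(** [CMu] looks for a zero, hence for one of the negated test. Naming the least solution by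
    [epsilon] gives the function that the program computes. *)
Lemma unbounded_search X t : dec_in X t ->
  (forall x, exists m, t (npair x m) = true) ->
  exists mu, rec_in X mu /\ forall x, t (npair x (mu x)) = true.
Proof.
intros Ht Hex.
set (least := fun x m =>
  t (npair x m) = true /\ forall m', m' < m -> t (npair x m') = false).
assert (Hleast : forall x, exists m, least x m).
{ intros x. destruct (Hex x) as [m Hm]. revert Hm.
  induction m as [m IH] using lt_wf_ind. intros Hm.
  destruct (classic (exists m', m' < m /\ t (npair x m') = true))
    as [[m' [L H]]|N]; [eauto|].
  exists m. split; [exact Hm|]. intros m' L. apply not_true_iff_false.
  intros H. apply N. eauto. }
set (mu := fun x => epsilon (inhabits 0) (least x)).
assert (Hmu : forall x, least x (mu x)).
{ intros x. apply epsilon_spec, Hleast. }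
exists mu. split; [|intros x; apply Hmu].
destruct (dec_negb Ht) as [c Hc]. exists (CMu c).
assert (H0 : forall z, eval X c z 0 <-> t z = true).
{ intros z. rewrite (Hc z 0). destruct (t z); simpl; intuition discriminate. }
assert (HS : forall z, (exists v, eval X c z (S v)) <-> t z = false).
{ intros z. split.
  - intros [v Hv]. apply Hc in Hv. now destruct (t z).
  - intros Hz. exists 0. apply Hc. now rewrite Hz. }
intros x y. simpl. rewrite H0. setoid_rewrite HS.
destruct (Hmu x) as [M1 M2]. split.
- intros [Y1 Y2]. destruct (Nat.lt_total y (mu x)) as [L|[L|L]]; trivial.
  + now rewrite (M2 y L) in Y1.
  + now rewrite (Y2 _ L) in M1.
- intros ->. auto.
Qed.

Theorem theorem7p1 :
  exists (L : language) (M : structure L nat) (K : computable_age L),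
    finite_relational L /\
    computable_structure M /\
    canonical_age M K /\
    CAP (age_of K) /\
    (forall s : nat -> Prop, cCAP K s -> turing_le zero_jump s).
Proof.
destruct graph_age as [K [Hcan [Hgens Hstr]]].
assert (HC : represents_graph (age_of K)).
{ intros T B. apply (canonical_age_represents Hcan). }
exists graph_language, graph, K.
split; [|split; [|split; [|split]]].
- split; [intros m []|]. exists [0]. intros n ->. now left.
- apply graph_computable.
- exact Hcan.
- now apply graph_CAP.
- intros s [AB [f [[[Hemb [_ [_ Htotal]]] [Hbase _]] [[p Hp] _]]]].
  destruct (char_fun_exists s) as [chi Hchi].
  assert (Rchi := rec_char_fun Hchi).
  (* One of the indices of [probe x] in the age. *)
  set (start := fun x => npair (list_code (probe x)) 0).
  assert (Hstart : forall x, tuple (start x) = probe x).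
  { intros x. apply tuple_code, probe_points. }
  (* A candidate pairs the code of an embedding with a number of steps. It is accepted if the code
     is enumerated into [AB] within these steps and its source is [start x]. *)
  destruct (@unbounded_search s (fun z =>
    haltsb chi p (nfst (nsnd z)) (nsnd (nsnd z)) &&
    (nsnd (nsnd (nfst (nfst (nsnd z)))) =? start (nfst z)))) as [mu [Rmu Hmu]].
  { apply dec_andb.
    - apply dec_haltsb; solve_rec.
    - apply dec_eqb; [solve_rec|]. unfold start.
      apply rec_npair; [apply rec_probe|]; solve_rec. }
  { intros x. destruct (Htotal (start x)) as [F [HF Hsrc]].
    assert (HW : W s p (emb_code K F)) by (apply Hp; eauto).
    apply (haltsb_W _ _ Hchi) in HW as [n Hn].
    exists (npair (emb_code K F) n). pair_simpl. rewrite Hn. simpl.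
    unfold emb_code, triple_code. pair_simpl. now apply Nat.eqb_eq. }
  (* The time bound is the code of the tuple generating the codomain. It exceeds every vertex of the
     codomain, in particular the mark of [x] if there is one, and so is large enough for the halting
     of program [x]. *)
  apply (@turing_le_dec _
    (fun x => halt x (nfst (nfst (nsnd (nfst (mu x))))))).
  { apply dec_halt; solve_rec. }
  intros x. rewrite zero_jump_halt. split; [|eauto].
  intros [n Hn]. specialize (Hmu x). pair_simpl.
  rewrite nfst_npair, nsnd_npair in Hmu.
  apply andb_true_iff in Hmu as [HW Hsrc]. apply Nat.eqb_eq in Hsrc.
  assert (H : W s p (nfst (mu x))) by (apply (haltsb_W _ _ Hchi); eauto).
  apply Hp in H as [F [HF E]]. rewrite E in *.
  unfold emb_code, triple_code in Hsrc |- *.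
  rewrite !nfst_npair, !nsnd_npair in Hsrc. pair_simpl.
  destruct (first_halt_exists x n Hn) as [w [_ Hw]].
  assert (B := Hbase F HF). destruct (Hemb F HF) as [Hpt Hat].
  unfold potential in Hpt. rewrite Hgens, Hstr, Hsrc, Hstart in Hat.
  rewrite Hstr in Hpt, B.
  destruct (@atomic_equiv_embedding _ _ _ Hat) as [g Hg].
  { intros y Hy. rewrite Forall_forall in Hpt.
    apply cl_graph. now apply Hpt. }
  apply (@base_contains_mark _ _ _ _ _ HC Hw (tuple_points _) Hg) in B.
  apply list_code_ge in B. rewrite Hgens.
  apply (@haltsb_mono _ _ _ (S w)).
  + assert (3 + w <= mark x w) by apply npair_ge_r. lia.
  + now apply andb_true_iff in Hw.
Qed.
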